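(* Let $q\in L_1(0,1)$ and consider the eigenvalue transmission problem for $(\lambda,u_1,u_2)$: $$u_1''+[\lambda-q(x)]u_1=0,\ x\in(0,\tfrac12),\qquad u_2''+[\lambda-q(x)]u_2=0,\ x\in(\tfrac12,1),$$ $$u_1(0)=u_2(1)=0,\quad u_1'(0)=1,\quad u_2(\tfrac12)-u_1(\tfrac12)=0,\quad u_2'(\tfrac12)-u_1'(\tfrac12)=1.$$ Let $(\lambda_n^{(j)},u_n^{(j)})_{j\ge0}$ be the FD-method sequence described in the context, started from the trial eigenpair $(\lambda_n^{(0)},u_n^{(0)})$, and let $\overset{m}{\lambda}_n=\sum_{j=0}^m\lambda_n^{(j)}$, $\overset{m}{u}_{n}=\sum_{j=0}^m u_n^{(j)}$ (componentwise on the two subintervals). Put $$R=\frac{1}{\frac{11}{3}\|q\|_{0,1}\left(1+\frac{16}{3}+2\sqrt{\frac{88}{9}}\right)}.$$ (a) Let $\lambda_n^{(0)}=4\pi^2(\pm\frac23+2n)^2$, $n\in\{0,1,2,\dots\}$, with $u_{n1}^{(0)}(x)=\sin(\sqrt{\lambda_n^{(0)}}x)/\sqrt{\lambda_n^{(0)}}$, $u_{n2}^{(0)}(x)=\sin(\sqrt{\lambda_n^{(0)}}(1-x))/\sqrt{\lambda_n^{(0)}}$ (with $\sqrt{\lambda_n^{(0)}}>0$), and assume $$r_n=\frac{(2+\sqrt3)\,\frac{11}{3}\|q\|_{0,1}\left(1+\frac{16}{3}+2\sqrt{\frac{88}{9}}\right)}{\sqrt3\sqrt{\lambda_n^{(0)}}}<1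 .$$ Then the series $\lambda_n=\sum_{j\ge0}\lambda_n^{(j)}$, $u_n=\sum_{j\ge0}u_n^{(j)}$ converge to the corresponding eigensolution $(\lambda_n,u_n)$ of the problem above, and there exist constants $c>0,\varepsilon>0$ such that, with $C=c/(1-r_n)$, for all $m\ge0$ $$\|u_n-\overset{m}{u}_n\|_\infty\le\frac{3C}{8(m+1)^{1+\varepsilon}\sqrt{\lambda_n^{(0)}}}\,r_n^{m+1},\qquad |\lambda_n-\overset{m}{\lambda}_n|\le\frac{C}{(m+1)^{1+\varepsilon}R}\,r_n^{m}.$$ (b) Let $\lambda_n^{(0)}=4\pi^2n^2$, $n\in\{1,2,\dots\}$, with $u_{n1}^{(0)}(x)=\frac{\sin(2\pi nx)}{2\pi n}$, $u_{n2}^{(0)}(x)=\frac{(-1)^n+1}{2\pi n}\sin(2\pi nx)$, and assume $r_n=\frac{1}{\pi nR}<1$. Then the series $\lambda_n=\sum_{j\ge0}\lambda_n^{(j)}$, $u_n=\sum_{j\ge0}u_n^{(j)}$ converge to the corresponding eigensolution $(\lambda_n,u_n)$ of the problem above, and there exist constants $c>0,\varepsilon>0$ such that, with $C=c/(1-r_n)$, for all $m\ge0$ $$|\lambda_n-\overset{m}{\lambda}_n|\le\frac{C}{(m+1)^{1+\varepsilon}R}\,r_n^{m},$$ and $\|u_n-\overset{m}{u}_n\|_\infty\le\frac{3C}{8\pi n(m+1)^{1+\varepsilon}}r_n^{m+1}$ if $n$ is even, while $\|u_n-\overset{m}{u}_n\|_\infty\le\frac{C}{8\pi n(m+1)^{1+\varepsilon}}r_n^{m+1}$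 if $n$ is odd.
   Context: Notation: a function $u$ on $[0,1]$ is a pair $(u_1,u_2)$ with $u_1$ on $[0,\frac12]$ and $u_2$ on $[\frac12,1]$; $\|u\|_\infty=\max\{\sup_{[0,1/2]}|u_1|,\sup_{[1/2,1]}|u_2|\}$ and $\|q\|_{0,1}=\int_0^1|q(x)|\,dx$. The jump at $\frac12$ is $[f(\frac12)]=f_2(\frac12)-f_1(\frac12)$. FD-method (functional-discrete method): the trial (zero-order) eigenpair $(\lambda_n^{(0)},u_n^{(0)})$ is an exact solution of the problem with $q\equiv0$ (given explicitly in (a) and (b)). For $j=0,1,2,\dots$, given $\lambda_n^{(0)},\dots,\lambda_n^{(j)}$ and $u_n^{(0)},\dots,u_n^{(j)}$, the correction $(\lambda_n^{(j+1)},u_n^{(j+1)})$ is defined as the (unique) real number $\lambda_n^{(j+1)}$ and function $u_n^{(j+1)}=(u_{n1}^{(j+1)},u_{n2}^{(j+1)})$ such that $$u_{ni}^{(j+1)\prime\prime}+\lambda_n^{(0)}u_{ni}^{(j+1)}=F_{ni}^{(j+1)},\quad i=1,2\ (\text{on }(0,\tfrac12)\text{ and }(\tfrac12,1)\text{ respectively}),$$ $$u_{n1}^{(j+1)}(0)=u_{n2}^{(j+1)}(1)=0,\quad u_{n1}^{(j+1)\prime}(0)=0,\quad [u_n^{(j+1)}(\tfrac12)]=0,\quad [u_n^{(j+1)\prime}(\tfrac12)]=0,$$ where $F_{ni}^{(j+1)}(x)=-\sum_{p=0}^{j}\lambda_n^{(j+1-p)}u_{ni}^{(p)}(x)+q(x)u_{ni}^{(j)}(x)$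 (the value $\lambda_n^{(j+1)}$ is fixed by the solvability of this overdetermined problem). The rank-$m$ approximation is $\overset{m}{\lambda}_n=\sum_{j=0}^m\lambda_n^{(j)}$, $\overset{m}{u}_{ni}=\sum_{j=0}^m u_{ni}^{(j)}$. *)

(* Defs.v *)
From HB Require Import structures.
From mathcomp Require Import all_boot all_order all_algebra.
From mathcomp Require Import all_classical all_reals all_analysis.
Set Implicit Arguments. Unset Strict Implicit. Unset Printing Implicit Defensive.
Import Order.TTheory GRing.Theory Num.Theory.
Import numFieldNormedType.Exports.
Local Open Scope classical_set_scope.
Local Open Scope ring_scope.

Section FD.
Variable R : realType.
Local Notation mu := (@lebesgue_measure R).

Definition Rint (f : R -> R) (a b : R) : R := \int[mu]_(x in `[a, b]) f x.

Definition L1on (f : R -> R) (a b : R) : Prop :=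
  mu.-integrable `[a, b] (EFin \o f).

Definition normL1 (q : R -> R) : R := Rint (fun x => `|q x|) 0 1.

(* Caratheodory solution of u'' = g on [a,b], du being u':
   u is the integral of du and du is absolutely continuous with du' = g a.e. *)
Definition sol_on (a b : R) (u du g : R -> R) : Prop :=
  L1on du a b /\ L1on g a b /\
  forall x, a <= x <= b ->
    u x = u a + Rint du a x /\ du x = du a + Rint g a x.

Definition eigsol (q : R -> R) (lam : R) (u1 u2 du1 du2 : R -> R) : Prop :=
  sol_on 0 (1/2) u1 du1 (fun x => (q x - lam) * u1 x) /\
  sol_on (1/2) 1 u2 du2 (fun x => (q x - lam) * u2 x) /\
  u1 0 = 0 /\ u2 1 = 0 /\ du1 0 = 1 /\
  u2 (1/2) - u1 (1/2) = 0 /\ du2 (1/2) - du1 (1/2) = 1.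

Definition FDrhs (q : R -> R) (lam : nat -> R) (u : nat -> R -> R) (j : nat)
  (x : R) : R :=
  - (\sum_(0 <= p < j.+1) lam (j.+1 - p)%N * u p x) + q x * u j x.

Definition FDseq (q : R -> R) (lam0 : R) (v1 v2 : R -> R)
  (lam : nat -> R) (u1 u2 du1 du2 : nat -> R -> R) : Prop :=
  lam 0%N = lam0 /\
  (forall x, 0 <= x <= 1/2 -> u1 0%N x = v1 x) /\
  (forall x, 1/2 <= x <= 1 -> u2 0%N x = v2 x) /\
  forall j : nat,
    sol_on 0 (1/2) (u1 j.+1) (du1 j.+1)
      (fun x => FDrhs q lam u1 j x - lam 0%N * u1 j.+1 x) /\
    sol_on (1/2) 1 (u2 j.+1) (du2 j.+1)
      (fun x => FDrhs q lam u2 j x - lam 0%N * u2 j.+1 x) /\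
    u1 j.+1 0 = 0 /\ u2 j.+1 1 = 0 /\ du1 j.+1 0 = 0 /\
    u2 j.+1 (1/2) - u1 j.+1 (1/2) = 0 /\
    du2 j.+1 (1/2) - du1 j.+1 (1/2) = 0.

Definition psum (a : nat -> R) (m : nat) : R := \sum_(j < m.+1) a j.

Definition Rconst (q : R -> R) : R :=
  1 / (11/3 * normL1 q * (1 + 16/3 + 2 * Num.sqrt (88/9))).

Definition FD_converges (q : R -> R) (lam0 : R) (v1 v2 : R -> R) (r Ku : R)
  : Prop :=
  (exists lam u1 u2 du1 du2, FDseq q lam0 v1 v2 lam u1 u2 du1 du2) /\
  forall lam u1 u2 du1 du2, FDseq q lam0 v1 v2 lam u1 u2 du1 du2 ->
    exists (L : R) (U1 U2 dU1 dU2 : R -> R),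
      eigsol q L U1 U2 dU1 dU2 /\
      psum lam @ \oo --> L /\
      (forall x, 0 <= x <= 1/2 -> psum (fun j => u1 j x) @ \oo --> U1 x) /\
      (forall x, 1/2 <= x <= 1 -> psum (fun j => u2 j x) @ \oo --> U2 x) /\
      exists c eps : R, 0 < c /\ 0 < eps /\
        let C := c / (1 - r) in
        forall m : nat,
          (forall x, 0 <= x <= 1/2 ->
             `|U1 x - psum (fun j => u1 j x) m|
               <= Ku * C / powR (m.+1)%:R (1 + eps) * r ^+ m.+1) /\
          (forall x, 1/2 <= x <= 1 ->
             `|U2 x - psum (fun j => u2 j x) m|
               <= Ku * C / powR (m.+1)%:R (1 + eps) * r ^+ m.+1) /\
          `|L - psum lam m|
            <= C / (powR (m.+1)%:R (1 + eps) * Rconst q) * r ^+ m.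

End FD.

(* Main.v *)
Require Import Defs.
From HB Require Import structures.
From mathcomp Require Import all_boot all_order all_algebra.
From mathcomp Require Import all_classical all_reals all_analysis.
From mathcomp Require Import measurable_realfun.
From mathcomp Require Import ring lra.
Import Order.TTheory GRing.Theory Num.Theory.
Import numFieldNormedType.Exports.
Local Open Scope ring_scope.

(** Glued along x = 1/2, every correction is a Caratheodory solution of
    u'' + k^2 u = F on the whole of [0,1] with zero Cauchy data at 0, so that
    k u(x) = int_0^x sin(k(x-t)) F(t) dt, and u(1) = 0 determines lam^(j+1) as
    a quotient by D = int_0^1 sin(k(1-t)) u^(0)(t) dt.  With M_j = sup |u^(j)|
    and T_j = |q|_1 M_j + sum_(1<=p<=j) |lam^(j+1-p)| M_p this gives
    |lam^(j+1)| <= T_j / |D| and k M_(j+1) <= (1 + M_0/|D|) T_j, a quadratic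
    convolution recursion for T_j.  Its generating function is bounded at every
    point where the associated quadratic equation has a supersolution, which
    yields T_j = O((h |q|_1)^j).  In all cases of the theorem h |q|_1 is smaller
    than r_n by a fixed factor (for n odd in (b), 90 against 92.3), so the
    tails are O(r_n^m / (m+1)^2), i.e. eps = 1. *)

Local Open Scope classical_set_scope.
Set Implicit Arguments. Unset Strict Implicit. Unset Printing Implicit Defensive.

(* [Num.Rint] of the archimedean library would shadow the integral. *)
Local Notation Rint := Defs.Rint.

(** * Interval integrals and bounded measurable functions *)

Section Integral.
Variable R : realType.
Local Notation mu := (@lebesgue_measure R).
Implicit Types (a b c d x y : R) (f g : R -> R).

(** Since [q] is only integrable, a derivative [du] is merely absolutely continuous and cannot be
    differentiated pointwise. All calculus is done on integral identities; its one nontrivial rule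
    is the product rule [primM], from which variation of constants follows. For the same reason the
    right-hand sides converge only up to a multiple of |q|, and limits are taken after integration.
    The constants come from one minimisation. Write B = beta/k, d = delta/k, s = sigma/k, h = eta/k.
    The supersolution condition becomes beta + kap (sigma + sigma^2/delta)/eta <= sigma with kap = 1
    + beta/delta. The best eta is the minimum over sigma > beta of kap (sigma +
    sigma^2/delta)/(sigma - beta), reached at sigma = beta + sqrt(beta^2 + beta delta). In each case
    [s] is a rational near this minimiser and [h] a rational slightly above the minimum. *)

Lemma L1onS a b c d f : L1on f a b -> a <= c -> d <= b -> L1on f c d.
Proof.
move=> + ac db; apply: integrableS => //.
by apply: subset_itv; rewrite bnd_simp.
Qed.

Lemma eq_L1on a b f g : (forall x, a <= x <= b -> f x = g x) ->
  L1on f a b -> L1on g a b.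
Proof.
move=> fg; apply: eq_integrable => // x /set_mem /=.
by rewrite in_itv /= => /fg ->.
Qed.

Lemma eq_Rint a b f g : (forall x, a <= x <= b -> f x = g x) ->
  Rint f a b = Rint g a b.
Proof.
move=> fg; apply: eq_Rintegral => x /set_mem /=.
by rewrite in_itv /= => /fg.
Qed.

Lemma L1onD a b f g : L1on f a b -> L1on g a b -> L1on (fun x => f x + g x) a b.
Proof.
move=> hf hg; rewrite /L1on.
suff -> : EFin \o (fun x => f x + g x) = ((EFin \o f) \+ (EFin \o g))%E.
  exact: integrableD.
by apply: funext => x /=; rewrite EFinD.
Qed.

Lemma L1onZ a b r f : L1on f a b -> L1on (fun x => r * f x) a b.
Proof.
move=> hf; rewrite /L1on.
suff -> : EFin \o (fun x => r * f x) = (fun x => r%:E * (EFin \o f) x)%E.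
  exact: integrableZl.
by apply: funext => x /=; rewrite EFinM.
Qed.

Lemma L1onN a b f : L1on f a b -> L1on (fun x => - f x) a b.
Proof.
by move=> /(@L1onZ _ _ (-1)); apply: eq_L1on => x _; rewrite mulN1r.
Qed.

Lemma L1onB a b f g : L1on f a b -> L1on g a b -> L1on (fun x => f x - g x) a b.
Proof. by move=> hf /L1onN; exact: L1onD. Qed.

Lemma L1on_abs a b f : L1on f a b -> L1on (fun x => `|f x|) a b.
Proof. by move=> /integrable_abse; apply: eq_integrable. Qed.

Lemma RintD a b f g : L1on f a b -> L1on g a b ->
  Rint (fun x => f x + g x) a b = Rint f a b + Rint g a b.
Proof. by move=> hf hg; exact: RintegralD. Qed.

Lemma RintB a b f g : L1on f a b -> L1on g a b ->
  Rint (fun x => f x - g x) a b = Rint f a b - Rint g a b.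
Proof. by move=> hf hg; exact: RintegralB. Qed.

Lemma RintZ a b r f : L1on f a b ->
  Rint (fun x => r * f x) a b = r * Rint f a b.
Proof. by move=> hf; exact: RintegralZl. Qed.

Lemma Rint_point a f : Rint f a a = 0.
Proof. by rewrite /Rint set_itv1 Rintegral_set1. Qed.

Lemma Rint_split a b c f : L1on f a b -> a <= c <= b ->
  Rint f a b = Rint f a c + Rint f c b.
Proof.
move=> hf /andP[ac cb].
have := @Rintegral_itvB R f (BLeft a) (BRight b) c hf.
rewrite !bnd_simp => /(_ ac cb) /eqP.
rewrite subr_eq addrC => /eqP.
rewrite (Rintegral_itv_obnd_cbnd (r := c)) //.
by apply: integrableS hf => //; apply: subset_itv; rewrite bnd_simp.
Qed.

Lemma le_Rint a b f g : L1on f a b -> L1on g a b ->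
  (forall x, a <= x <= b -> f x <= g x) -> Rint f a b <= Rint g a b.
Proof.
by move=> hf hg fg; apply: le_Rintegral.
Qed.

Lemma le_norm_Rint a b f : L1on f a b ->
  `|Rint f a b| <= Rint (fun x => `|f x|) a b.
Proof. by move=> hf; exact: le_normr_Rintegral. Qed.

Lemma L1on_cst a b r : L1on (fun=> r) a b.
Proof. by apply: continuous_compact_integrable => //;
  [exact: segment_compact | apply: continuous_subspaceT => x; exact: cst_continuous]. Qed.

Lemma Rint_cst a b r : a <= b -> Rint (fun=> r) a b = r * (b - a).
Proof.
move=> ab; rewrite /Rint Rintegral_cst //= lebesgue_measure_itv /= lte_fin.
by case: ltgtP ab => // -> _ /=; rewrite subrr.
Qed.

Lemma Rint_le_norm a b f g : L1on f a b -> L1on g a b ->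
  (forall x, a <= x <= b -> `|f x| <= g x) -> `|Rint f a b| <= Rint g a b.
Proof.
move=> hf hg fg; apply: le_trans (le_norm_Rint hf) _.
exact: le_Rint (L1on_abs hf) hg fg.
Qed.

Lemma Rint_ge0 a b f : (forall x, a <= x <= b -> 0 <= f x) -> 0 <= Rint f a b.
Proof.
by move=> f0; exact: Rintegral_ge0.
Qed.

Lemma Rint_le_sub a b c d f : L1on f a b -> (forall x, a <= x <= b -> 0 <= f x) ->
  a <= c -> c <= d -> d <= b -> Rint f c d <= Rint f a b.
Proof.
move=> hf f0 ac cd db.
rewrite (Rint_split (c := c) hf) ?ac ?(le_trans cd db) //.
rewrite (Rint_split (a := c) (b := b) (c := d)) ?cd ?db //; last first.
  by exact: L1onS hf ac _.
rewrite addrCA lerDl addr_ge0 // Rint_ge0 // => x /andP[h1 h2];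
  apply: f0; lra.
Qed.

Lemma Rint_continuous a b f : a <= b -> L1on f a b ->
  {within `[a, b], continuous (fun x => Rint f a x)}.
Proof. exact: parameterized_integral_continuous. Qed.

(** The class of multipliers: it maps L1 to L1, is closed under sums, products and gluing, and asks
    for no continuity, so it also receives the pointwise limit of the partial sums. *)
Definition bdm a b f := measurable_fun `[a, b] f /\
  exists B, forall x, a <= x <= b -> `|f x| <= B.

Lemma L1onM_bdm a b f g : bdm a b f -> L1on g a b -> L1on (fun x => f x * g x) a b.
Proof.
move=> [mf [B hB]] hg.
apply: (@le_integrable _ _ _ mu _ _ _ (fun x => (B * `|g x|)%:E)) => //.
- apply/measurable_EFinP; apply: measurable_funM => //.
  by apply/measurable_EFinP; exact: measurable_int hg.
- move=> x /=; rewrite in_itv /= => /hB fB.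
  rewrite lee_fin normrM [leRHS]ger0_norm ?mulr_ge0 //.
    by rewrite ler_wpM2r.
  exact: le_trans fB.
- exact: L1onZ (L1on_abs hg).
Qed.

Lemma bdm_L1on a b f : bdm a b f -> L1on f a b.
Proof.
move=> /L1onM_bdm /(_ (L1on_cst a b 1)).
by apply: eq_L1on => x _; rewrite mulr1.
Qed.

Lemma bdmD a b f g : bdm a b f -> bdm a b g -> bdm a b (fun x => f x + g x).
Proof.
move=> [mf [A hA]] [mg [B hB]]; split; first exact: measurable_funD.
exists (A + B) => x xab; apply: le_trans (ler_normD _ _) _.
by rewrite lerD ?hA ?hB.
Qed.

Lemma bdmM a b f g : bdm a b f -> bdm a b g -> bdm a b (fun x => f x * g x).
Proof.
move=> [mf [A hA]] [mg [B hB]]; split; first exact: measurable_funM.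
exists (A * B) => x xab; rewrite normrM.
by rewrite ler_pM ?hA ?hB.
Qed.

Lemma bdm_cst a b r : bdm a b (fun=> r).
Proof. by split; [exact: measurable_cst | exists `|r|]. Qed.

Lemma bdmZ a b r f : bdm a b f -> bdm a b (fun x => r * f x).
Proof. exact: bdmM (bdm_cst _ _ _). Qed.

Lemma bdm_sum a b (f : nat -> R -> R) m n :
  (forall i, (m <= i < n)%N -> bdm a b (f i)) ->
  bdm a b (fun x => \sum_(m <= i < n) f i x).
Proof.
move=> hf.
have [nm|/ltnW mn] := leqP n m.
  suff -> : (fun x => \sum_(m <= i < n) f i x) = (fun=> 0) by exact: bdm_cst.
  by apply: funext => x; rewrite big_geq.
elim: n mn hf => [|n IH].
  rewrite leqn0 => /eqP -> _.
  suff -> : (fun x => \sum_(0 <= i < 0) f i x) = (fun=> 0) by exact: bdm_cst.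
  by apply: funext => x; rewrite big_geq.
rewrite leq_eqVlt => /predU1P[-> hf|].
  suff -> : (fun x => \sum_(n.+1 <= i < n.+1) f i x) = (fun=> 0) by exact: bdm_cst.
  by apply: funext => x; rewrite big_geq.
rewrite ltnS => mn hf.
suff -> : (fun x => \sum_(m <= i < n.+1) f i x)
  = (fun x => \sum_(m <= i < n) f i x + f n x).
  apply: bdmD; last by apply: hf; rewrite mn /=.
  by apply: IH => // i /andP[mi ni]; apply: hf; rewrite mi /= ltnS ltnW.
by apply: funext => x; rewrite big_nat_recr.
Qed.

Lemma continuous_bdm a b f : a <= b -> {within `[a, b], continuous f} -> bdm a b f.
Proof.
move=> ab cf; split.
  by apply: subspace_continuous_measurable_fun.
have [x1 _ h1] := EVT_max ab cf; have [x2 _ h2] := EVT_min ab cf.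
exists (`|f x1| + `|f x2|) => x xab.
have := h1 x; have := h2 x; rewrite in_itv /= => /(_ xab) + /(_ xab).
rewrite ler_norml => ? ?; have := ler_norm (f x1).
by have := ler_norm (- f x2); rewrite normrN; have := normr_ge0 (f x1);
 have := normr_ge0 (f x2); lra.
Qed.

Lemma eq_bdm a b f g : (forall x, a <= x <= b -> f x = g x) -> bdm a b f -> bdm a b g.
Proof.
move=> fg [mf [B hB]]; split.
  apply: eq_measurable_fun mf => x /set_mem /=.
  by rewrite in_itv /= => /fg.
by exists B => x xab; rewrite -fg // hB.
Qed.

End Integral.

(** * Absolutely continuous functions *)

Section Primitive.
Variable R : realType.
Implicit Types (a b c d x y : R) (f g df dg : R -> R).

(** Absolute continuity expressed through the fundamental theorem, one half of [sol_on]. [df] is a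
    chosen density; a.e. differentiability never enters. *)
Definition prim a b f df := L1on df a b /\
  forall x, a <= x <= b -> f x = f a + Rint df a x.

Lemma sol_onE a b (u du g : R -> R) :
  sol_on a b u du g <-> prim a b u du /\ prim a b du g.
Proof.
split=> [[h1 [h2 h]]|[[h1 h] [h2 h']]].
  by split; split=> // x /h [].
by split=> //; split=> // x xab; split; [exact: h | exact: h'].
Qed.

Lemma prim_incr a b f df x y : prim a b f df -> a <= x -> x <= y -> y <= b ->
  f y - f x = Rint df x y.
Proof.
move=> [hd hf] ax xy yb.
rewrite (hf y) ?(le_trans ax xy) // (hf x) ?ax ?(le_trans xy yb) //.
rewrite (Rint_split (b := y) (c := x)) ?ax ?xy //; first by lra.
by apply: (L1onS hd).
Qed.

Lemma primS a b c d f df : prim a b f df -> a <= c -> d <= b -> prim c d f df.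
Proof.
move=> hf ac db; split; first by apply: L1onS ac db; exact: hf.1.
move=> x /andP[cx xd].
by rewrite -(prim_incr hf ac cx (le_trans xd db)); lra.
Qed.

Lemma eq_prim a b f g df dg : (forall x, a <= x <= b -> f x = g x) ->
  (forall x, a <= x <= b -> df x = dg x) -> prim a b f df -> prim a b g dg.
Proof.
move=> fg dfg [hd hf]; split; first exact: eq_L1on hd.
move=> x /[dup] xab /andP[ax xb].
rewrite -!fg // ?lexx ?(le_trans ax xb) // hf //; congr (_ + _).
by apply: eq_Rint => t /andP[h1 h2]; apply: dfg; rewrite h1 (le_trans h2).
Qed.

Lemma primD a b f g df dg : prim a b f df -> prim a b g dg ->
  prim a b (fun x => f x + g x) (fun x => df x + dg x).
Proof.
move=> [hd hf] [kd kg]; split; first exact: L1onD.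
move=> x /[dup] xab /andP[ax xb].
have hd' : L1on df a x by apply: (L1onS hd).
have kd' : L1on dg a x by apply: (L1onS kd).
by rewrite (RintD hd' kd') (hf x xab) (kg x xab); ring.
Qed.

Lemma primZ a b r f df : prim a b f df ->
  prim a b (fun x => r * f x) (fun x => r * df x).
Proof.
move=> [hd hf]; split; first exact: L1onZ.
move=> x /[dup] xab /andP[ax xb].
have hd' : L1on df a x by apply: (L1onS hd).
by rewrite (RintZ _ hd') (hf x xab) mulrDr.
Qed.

Lemma primB a b f g df dg : prim a b f df -> prim a b g dg ->
  prim a b (fun x => f x - g x) (fun x => df x - dg x).
Proof.
move=> hf /(primZ (-1)) hg; have := primD hf hg.
by apply: eq_prim => x _; rewrite mulN1r.
Qed.

Lemma prim_cst a b r : prim a b (fun=> r) (fun=> 0).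
Proof.
split; first exact: L1on_cst.
by move=> x /andP[ax xb]; rewrite Rint_cst // mul0r addr0.
Qed.

Lemma prim_sum a b (f df : nat -> R -> R) m : (forall j, prim a b (f j) (df j)) ->
  prim a b (fun x => \sum_(0 <= j < m) f j x) (fun x => \sum_(0 <= j < m) df j x).
Proof.
move=> hf; elim: m => [|m IH].
  by apply: eq_prim (prim_cst a b 0) => x _; rewrite big_geq.
by apply: eq_prim (primD IH (hf m)) => x _; rewrite [RHS]big_nat_recr.
Qed.

Lemma prim_Rint a b f : L1on f a b -> prim a b (fun x => Rint f a x) f.
Proof. by move=> hf; split => // x _; rewrite Rint_point add0r. Qed.

Lemma prim_continuous a b f df : a <= b -> prim a b f df ->
  {within `[a, b], continuous f}.
Proof.
move=> ab [hd hf].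
have fE : {in `[a, b]%classic, (fun x => f a + Rint df a x) =1 f}.
  by move=> x; rewrite inE /= in_itv /= => /hf ->.
apply: (subspace_eq_continuous fE) => x; apply: cvgD; first exact: cvg_cst.
exact: Rint_continuous.
Qed.

Lemma prim_bdm a b f df : a <= b -> prim a b f df -> bdm a b f.
Proof. by move=> ab /(prim_continuous ab); exact: continuous_bdm. Qed.

Lemma L1on_cat a b c f : a <= c -> c <= b -> L1on f a c -> L1on f c b -> L1on f a b.
Proof.
move=> ac cb h1 h2.
have h2' : (@lebesgue_measure R).-integrable `]c, b] (EFin \o f).
  apply: integrableS h2 => //.
  by apply: subset_itv; rewrite bnd_simp.
have m1 := measurable_int _ h1; have m2 := measurable_int _ h2'.
have E : `[a, b]%classic = `[a, c] `|` `]c, b].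
  by rewrite -itv_bndbnd_setU ?bnd_simp.
have mU : measurable_fun (`[a, c] `|` `]c, b]) (EFin \o f).
  exact/measurable_funU.
rewrite /L1on E; apply/integrableP; split => //.
rewrite ge0_integral_setU //=.
- move/integrableP: h1 => [_ i1]; move/integrableP: h2' => [_ i2].
  exact: lte_add_pinfty.
- by do 2 apply: measurableT_comp => //; exact/measurable_EFinP.
- apply/disj_setPS => y [/=]; rewrite !in_itv /= => /andP[_ yc] /andP[].
  by rewrite ltNge yc.
Qed.

Lemma prim_cat a b c f df : a <= c -> c <= b ->
  prim a c f df -> prim c b f df -> prim a b f df.
Proof.
move=> ac cb [hd hf] [kd kf].
have hdf : L1on df a b by exact: L1on_cat hd kd.
split=> // x /andP[ax xb]; have [xc|/ltW cx] := leP x c; first by rewrite hf ?ax.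
rewrite kf ?cx // hf ?ac ?lexx // -addrA -Rint_split ?ac ?cx //.
by apply: (L1onS hdf).
Qed.

(* The partition is taken in the values of [W], so that each of its [n] steps
   contributes [C (W b - W a)^2 / n^2]. *)
Lemma eq_of_sq_bound a b (G W : R -> R) C : a <= b -> 0 <= C -> W a <= W b ->
  {within `[a, b], continuous W} ->
  (forall x y, a <= x -> x <= y -> y <= b ->
     `|G y - G x| <= C * (W y - W x) ^+ 2) ->
  G a = G b.
Proof.
move=> ab C0 Wab cW hG.
(* The point produced below by [IVT] is known only through its [W]-value and may lie on either side
   of [x]; hence a bound without an order between the arguments. *)
have hG2 x y : a <= x <= b -> a <= y <= b -> `|G y - G x| <= C * (W y - W x) ^+ 2.
  move=> /andP[ax xb] /andP[ay yb]; have [xy|/ltW yx] := leP x y; first exact: hG.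
  by rewrite distrC -sqrrN opprB; exact: hG.
have step n : (0 < n)%N -> n%:R * `|G b - G a| <= C * (W b - W a) ^+ 2.
  move=> n0; have n0' : 0 < n%:R :> R by rewrite ltr0n.
  pose e := (W b - W a) / n%:R.
  have e0 : 0 <= e by rewrite divr_ge0 // ?subr_ge0 // ltW.
  have ne : n%:R * e = W b - W a by rewrite /e mulrC divfK // gt_eqF.
  have ind i : (i <= n)%N -> forall x, a <= x <= b -> W x = W a + i%:R * e ->
      `|G x - G a| <= i%:R * (C * e ^+ 2).
    elim: i => [_ x xab Wx|i IH ni x xab Wx].
      apply: le_trans (hG2 _ _ _ xab) _; first by rewrite lexx.
      by rewrite Wx !mul0r addr0 subrr expr0n mulr0.
    have [|y] := @IVT R W a b (W a + i%:R * e) ab cW.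
      rewrite min_l // max_r // lerDl mulr_ge0 //=.
      have : i%:R * e <= n%:R * e by rewrite ler_wpM2r // ler_nat ltnW.
      by rewrite ne; lra.
    rewrite in_itv /= => yab Wy.
    have := IH (ltnW ni) y yab Wy; have := hG2 _ _ yab xab.
    have -> : W x - W y = e by rewrite Wx Wy -natr1; ring.
    rewrite -(natr1 i) mulrDl mul1r => h1 h2.
    have -> : G x - G a = (G y - G a) + (G x - G y) by ring.
    exact: le_trans (ler_normD _ _) (lerD h2 h1).
  have := ind n (leqnn n) b; rewrite ab lexx /= => /(_ isT).
  rewrite ne => /(_ _)/wrap[|h]; first by lra.
  apply: le_trans (ler_wpM2l (ltW n0') h) _.
  have -> : W b - W a = n%:R * e by [].
  by rewrite le_eqVlt; apply/orP; left; apply/eqP; ring.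
apply/eqP/negP => /negP Gab.
have d0 : 0 < `|G b - G a| by rewrite normr_gt0 subr_eq0 eq_sym.
set K := C * _ in step.
have K0 : 0 <= K / `|G b - G a| by rewrite divr_ge0 // mulr_ge0 // sqr_ge0.
have [m hm] : exists m : nat, K / `|G b - G a| < m%:R.
  by exists (Num.bound (K / `|G b - G a|)); exact: archi_boundP.
have m0 : (0 < m)%N by rewrite -(ltr0n R); exact: le_lt_trans hm.
have := step m m0; rewrite leNgt => /negP; apply.
by rewrite -ltr_pdivrMr.
Qed.

(** Let G be f g minus the integral of df g + f dg. On [x, y] the first-order parts cancel, and G
    changes by at most twice the square of the integral of |df| + |dg|. [eq_of_sq_bound], with that
    integral as [W], makes G constant. *)
Lemma primM a b f g df dg : a <= b -> prim a b f df -> prim a b g dg ->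
  prim a b (fun x => f x * g x) (fun x => df x * g x + f x * dg x).
Proof.
move=> ab hf hg.
have bf := prim_bdm ab hf; have bg := prim_bdm ab hg.
have L1 : L1on (fun x => df x * g x) a b.
  have := L1onM_bdm bg hf.1.
  by apply: eq_L1on => x _; rewrite mulrC.
have L2 : L1on (fun x => f x * dg x) a b := L1onM_bdm bf hg.1.
split; first exact: L1onD.
pose w x := `|df x| + `|dg x|; pose h x := df x * g x + f x * dg x.
have Lw : L1on w a b by apply: L1onD; apply: L1on_abs; [exact: hf.1|exact: hg.1].
have Lh : L1on h a b by exact: L1onD.
have w0 x : 0 <= w x by rewrite addr_ge0.
have dle x y : a <= x -> x <= y -> y <= b ->
    `|f y - f x| <= Rint w x y /\ `|g y - g x| <= Rint w x y.
  move=> ax xy yb; rewrite (prim_incr hf ax xy yb) (prim_incr hg ax xy yb).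
  have Lwxy : L1on w x y by apply: (L1onS Lw).
  split; apply: Rint_le_norm => //.
  - by apply: L1onS ax yb; exact: hf.1.
  - by move=> t _; rewrite lerDl.
  - by apply: L1onS ax yb; exact: hg.1.
  - by move=> t _; rewrite lerDr.
have key x y : a <= x -> x <= y -> y <= b ->
    `|(f y * g y - Rint h a y) - (f x * g x - Rint h a x)|
      <= 2 * (Rint w a y - Rint w a x) ^+ 2.
  move=> ax xy yb.
  have ay := le_trans ax xy; have xb := le_trans xy yb.
  have hw : Rint w a y - Rint w a x = Rint w x y.
    rewrite (Rint_split (b := y) (c := x)) ?ax ?xy //; first by lra.
    by apply: (L1onS Lw).
  have hh : Rint h a y - Rint h a x = Rint h x y.
    rewrite (Rint_split (b := y) (c := x)) ?ax ?xy //; first by lra.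
    by apply: (L1onS Lh).
  have [d1 d2] := dle _ _ ax xy yb.
  rewrite hw; set v := Rint w x y in d1 d2 *.
  have v0 : 0 <= v by exact: le_trans (normr_ge0 _) d1.
  (* Freezing the factors at [x] isolates the second-order part: the increment of f g minus the
     integral of [h] equals (f y - f x)(g y - g x) minus the integral of [h1]. *)
  pose h1 t := (g t - g x) * df t + (f t - f x) * dg t.
  have Lf : L1on df x y by apply: L1onS ax yb; exact: hf.1.
  have Lg : L1on dg x y by apply: L1onS ax yb; exact: hg.1.
  have Lhxy : L1on h x y by apply: (L1onS Lh).
  have h1E : Rint h1 x y = Rint h x y - (g x * (f y - f x) + f x * (g y - g x)).
    rewrite (prim_incr hf ax xy yb) (prim_incr hg ax xy yb).
    have Z1 := L1onZ (g x) Lf; have Z2 := L1onZ (f x) Lg.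
    rewrite -(RintZ _ Lf) -(RintZ _ Lg) -(RintD Z1 Z2) -(RintB Lhxy (L1onD Z1 Z2)).
    by apply: eq_Rint => t _; rewrite /h1 /h; ring.
  have Lh1 : L1on h1 x y.
    have : L1on (fun t => h t - (g x * df t + f x * dg t)) x y.
      by apply: L1onB => //; apply: L1onD; exact: L1onZ.
    by apply: eq_L1on => t _; rewrite /h1 /h; ring.
  have -> : f y * g y - Rint h a y - (f x * g x - Rint h a x)
     = (f y - f x) * (g y - g x) - Rint h1 x y.
    by rewrite h1E -hh; ring.
  apply: le_trans (ler_normB _ _) _.
  have -> : 2 * v ^+ 2 = v * v + v * v by ring.
  apply: lerD; first by rewrite normrM ler_pM.
  have Lwxy : L1on w x y by apply: (L1onS Lw).
  have <- : Rint (fun t => v * w t) x y = v * v by rewrite RintZ.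
  apply: Rint_le_norm => //; first exact: L1onZ.
  move=> t /andP[xt ty]; apply: le_trans (ler_normD _ _) _.
  have tb := le_trans ty yb.
  have [e1 e2] := dle _ _ ax xt tb.
  have wv : Rint w x t <= v.
    by apply: (Rint_le_sub (a := x) (b := y)) => //; by apply: (L1onS Lw).
  rewrite /w mulrDr !normrM.
  by apply: lerD; rewrite ler_wpM2r // (le_trans _ wv).
move=> x /andP[ax xb].
have Lwx : L1on w a x by apply: (L1onS Lw).
have : f a * g a - Rint h a a = f x * g x - Rint h a x.
  apply: (@eq_of_sq_bound a x (fun y => f y * g y - Rint h a y)
    (fun y => Rint w a y) 2) => //.
  - by rewrite Rint_point Rint_ge0.
  - exact: Rint_continuous.
  - by move=> y z ay yz zx; apply: key => //; exact: le_trans xb.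
by rewrite Rint_point -/h; lra.
Qed.

Lemma prim_C1 a b f df : (forall x, is_derive x 1 f (df x)) -> continuous df ->
  prim a b f df.
Proof.
move=> hf cdf; split.
  by apply: continuous_compact_integrable;
    [exact: segment_compact | exact: continuous_subspaceT].
move=> x /andP[+ _]; rewrite le_eqVlt => /predU1P[<-|ax].
  by rewrite Rint_point addr0.
have cf y : {for y, continuous f}.
  by apply/differentiable_continuous/derivable1_diffP; have := hf y; case.
rewrite /Rint /Rintegral (@continuous_FTC2 _ _ f) //=; first by lra.
- exact: continuous_subspaceT.
- split.
  + by move=> y _; have := hf y; case.
  + by apply: cvg_at_right_filter; exact: cf.
  + by apply: cvg_at_left_filter; exact: cf.
- by move=> y _; rewrite derive1E; have [_ ->] := hf y.
Qed.

End Primitive.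

(** * The harmonic oscillator with an integrable right-hand side *)

Section Oscillator.
Variable R : realType.
Implicit Types (a b k x : R) (u du F : R -> R).

Lemma prim_sin a b k : prim a b (fun x => sin (k * x)) (fun x => k * cos (k * x)).
Proof.
apply: prim_C1 => [x|].
  apply: is_derive_eq; by rewrite /GRing.scale /=; ring.
move=> x; apply: cvgM; first exact: cvg_cst.
apply: continuous_comp; last exact: continuous_cos.
by apply: cvgM; [exact: cvg_cst | exact: cvg_id].
Qed.

Lemma prim_cos a b k : prim a b (fun x => cos (k * x)) (fun x => - k * sin (k * x)).
Proof.
apply: prim_C1 => [x|].
  apply: is_derive_eq; by rewrite /GRing.scale /=; ring.
move=> x; apply: cvgM; first exact: cvg_cst.
apply: continuous_comp; last exact: continuous_sin.
by apply: cvgM; [exact: cvg_cst | exact: cvg_id].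
Qed.

Lemma L1on_sin a b k F : a <= b -> L1on F a b -> L1on (fun t => sin (k * t) * F t) a b.
Proof. by move=> ab; apply: L1onM_bdm; apply: prim_bdm (prim_sin a b k). Qed.

Lemma L1on_cos a b k F : a <= b -> L1on F a b -> L1on (fun t => cos (k * t) * F t) a b.
Proof. by move=> ab; apply: L1onM_bdm; apply: prim_bdm (prim_cos a b k). Qed.

(** The addition formula takes the outer variable out of the kernel. The convolution becomes a
    combination of products of primitives, to which [primM] applies in place of differentiation
    under the integral. *)
Lemma Rint_sinB b k F x : 0 <= b -> L1on F 0 b -> 0 <= x <= b -> forall y,
  Rint (fun t => sin (k * (y - t)) * F t) 0 x =
  sin (k * y) * Rint (fun t => cos (k * t) * F t) 0 x
  - cos (k * y) * Rint (fun t => sin (k * t) * F t) 0 x.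
Proof.
move=> b0 hF /andP[x0 xb] y.
have hF' : L1on F 0 x by apply: (L1onS hF).
have hs := L1on_sin k x0 hF'; have hc := L1on_cos k x0 hF'.
rewrite -(RintZ _ hs) -(RintZ _ hc) -RintB; [|exact: L1onZ..].
by apply: eq_Rint => t _; rewrite mulrBr sinB; ring.
Qed.

Lemma Rint_cosB b k F x : 0 <= b -> L1on F 0 b -> 0 <= x <= b -> forall y,
  Rint (fun t => cos (k * (y - t)) * F t) 0 x =
  cos (k * y) * Rint (fun t => cos (k * t) * F t) 0 x
  + sin (k * y) * Rint (fun t => sin (k * t) * F t) 0 x.
Proof.
move=> b0 hF /andP[x0 xb] y.
have hF' : L1on F 0 x by apply: (L1onS hF).
have hs := L1on_sin k x0 hF'; have hc := L1on_cos k x0 hF'.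
rewrite -(RintZ _ hs) -(RintZ _ hc) -RintD; [|exact: L1onZ..].
by apply: eq_Rint => t _; rewrite mulrBr cosB; ring.
Qed.

(** Variation of constants. A = cos(kx) u' + k sin(kx) u and B = sin(kx) u' - k cos(kx) u have
    densities cos(kx) F and sin(kx) F, in which u has cancelled. With zero data at 0 both are plain
    integrals, and sin(kx) A - cos(kx) B = k u. *)
Lemma oscillator_repr b k u du F : 0 <= b -> L1on F 0 b ->
  sol_on 0 b u du (fun x => F x - k ^+ 2 * u x) -> u 0 = 0 -> du 0 = 0 ->
  forall x, 0 <= x <= b ->
  k * u x = Rint (fun t => sin (k * (x - t)) * F t) 0 x.
Proof.
move=> b0 hF /sol_onE[hu hdu] u0 du0 x xb.
have hs := prim_sin 0 b k; have hc := prim_cos 0 b k.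
have hA : prim 0 b (fun x => cos (k * x) * du x + k * (sin (k * x) * u x))
    (fun x => cos (k * x) * F x).
  have := primD (primM b0 hc hdu) (primZ k (primM b0 hs hu)).
  by apply: eq_prim => t _ //; ring.
have hB : prim 0 b (fun x => sin (k * x) * du x - k * (cos (k * x) * u x))
    (fun x => sin (k * x) * F x).
  have := primB (primM b0 hs hdu) (primZ k (primM b0 hc hu)).
  by apply: eq_prim => t _ //; ring.
rewrite (Rint_sinB k b0 hF xb x).
have := hA.2 _ xb; have := hB.2 _ xb.
rewrite u0 du0 !mulr0 subrr addr0 !add0r => <- <-.
have := cos2Dsin2 (k * x); set s := sin _; set c := cos _ => h.
have -> : k * u x = k * u x * (c ^+ 2 + s ^+ 2) by rewrite h mulr1.
by ring.
Qed.

Lemma oscillator_sol b k F : 0 <= b -> k != 0 -> L1on F 0 b ->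
  sol_on 0 b (fun x => Rint (fun t => sin (k * (x - t)) * F t) 0 x / k)
    (fun x => Rint (fun t => cos (k * (x - t)) * F t) 0 x)
    (fun x => F x - k ^+ 2 * (Rint (fun t => sin (k * (x - t)) * F t) 0 x / k)).
Proof.
move=> b0 k0 hF.
have hs := prim_sin 0 b k; have hc := prim_cos 0 b k.
have hS := prim_Rint (L1on_sin k b0 hF); have hC := prim_Rint (L1on_cos k b0 hF).
apply/sol_onE; split.
- have := primZ k^-1 (primB (primM b0 hs hC) (primM b0 hc hS)).
  apply: eq_prim => t tb.
    by rewrite (Rint_sinB k b0 hF tb) mulrC.
  rewrite (Rint_cosB k b0 hF tb).
  by field.
- have := primD (primM b0 hc hC) (primM b0 hs hS).
  apply: eq_prim => t tb.
    by rewrite (Rint_cosB k b0 hF tb).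
  rewrite (Rint_sinB k b0 hF tb).
  have := cos2Dsin2 (k * t); set s := sin _; set c := cos _ => h.
  rewrite -[F t in RHS]mulr1 -h.
  by field.
Qed.

Lemma bdm_sinB b k x : 0 <= b -> bdm 0 b (fun t => sin (k * (x - t))).
Proof.
move=> b0; apply: continuous_bdm => //; apply: continuous_subspaceT => t.
apply: continuous_comp; last exact: continuous_sin.
apply: cvgM; first exact: cvg_cst.
by apply: cvgB; [exact: cvg_cst | exact: cvg_id].
Qed.

Lemma sin_abs_le1 (x : R) : `|sin x| <= 1.
Proof. by rewrite ler_norml sin_geN1 sin_le1. Qed.

End Oscillator.

(** * Numerical sequences *)

Section Sequences.
Variable R : realType.

Lemma sum_triangle (F : nat -> nat -> R) n :
  \sum_(0 <= j < n) \sum_(0 <= p < j.+1) F p (j - p)%N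
  = \sum_(0 <= p < n) \sum_(0 <= i < n - p) F p i.
Proof.
elim: n => [|n IH]; first by rewrite !big_geq.
rewrite big_nat_recr //= IH.
rewrite [in RHS]big_nat_recr //= subSnn big_nat1.
rewrite [in X in _ + X = _]big_nat_recr //= subnn addrA; congr (_ + _).
rewrite -big_split /= !big_nat; apply: eq_bigr => p /andP[_ pn].
by rewrite subSn 1?ltnW // big_nat_recr.
Qed.

Lemma sum_nat_ge0 (x : nat -> R) m n : (forall j, 0 <= x j) ->
  0 <= \sum_(m <= j < n) x j.
Proof. by move=> x0; apply: sumr_ge0. Qed.

Lemma ler_sum_nat_widen (x : nat -> R) m n : (forall j, 0 <= x j) -> (m <= n)%N ->
  \sum_(0 <= j < m) x j <= \sum_(0 <= j < n) x j.
Proof.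
move=> x0 mn; rewrite [leRHS](big_cat_nat (leq0n m) mn) /= lerDl.
exact: sum_nat_ge0.
Qed.

(** The triangle of index pairs lies inside the square, and all terms are nonnegative. *)
Lemma sum_conv_le (x : nat -> R) n : (forall j, 0 <= x j) ->
  \sum_(0 <= j < n) \sum_(0 <= p < j.+1) x (j - p)%N * x p
  <= (\sum_(0 <= j < n) x j) ^+ 2.
Proof.
move=> x0; rewrite (sum_triangle (fun p i => x i * x p)).
rewrite expr2 mulr_sumr ler_sum // => p _.
rewrite -mulr_suml ler_wpM2r //.
exact/ler_sum_nat_widen/leq_subr.
Qed.

(* [s] is a supersolution of the quadratic equation satisfied by the generating
   function of the majorant; it dominates all partial sums of
   [\sum_j T j * z ^ j] at [z = 1 / (Q * h)]. *)
Lemma quadratic_majorant (T : nat -> R) (Q B a b h s : R) :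
  (forall j, 0 <= T j) -> 0 <= Q -> 0 <= B -> 0 <= a -> 0 <= b -> 0 < h -> 0 <= s ->
  B + (a * s + b * s ^+ 2) / h <= s ->
  T 0%N <= Q * B ->
  (forall j, T j.+1 <= Q * a * T j + b * \sum_(0 <= p < j.+1) T (j - p)%N * T p) ->
  forall j, T j <= Q * s * (Q * h) ^+ j.
Proof.
move=> T0 Q0 B0 a0 b0 h0 s0 hs hT0 hT.
(* For [Q] = 0 the point z = 1/(Q h) does not exist, but then the recursion forces every [T j] to
   vanish. *)
move: Q0; rewrite le_eqVlt => /predU1P[Q0|Q0].
  have TE : forall n j, (j <= n)%N -> T j = 0.
    elim=> [|n IH] j.
      rewrite leqn0 => /eqP ->; apply/le_anti; rewrite T0 andbT.
      by rewrite -Q0 mul0r in hT0.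
    rewrite leq_eqVlt => /predU1P[->|]; last exact: IH.
    apply/le_anti; rewrite T0 andbT; apply: le_trans (hT n) _.
    rewrite -Q0 !mul0r add0r big_nat big1 ?mulr0 // => p /andP[_ pn].
    by rewrite (IH p) ?mulr0.
  by move=> j; rewrite (TE j j) // -Q0 !mul0r.
pose z := (Q * h)^-1; pose x j := T j * z ^+ j.
have Qh0 : 0 < Q * h by rewrite mulr_gt0.
have z0 : 0 < z by rewrite invr_gt0.
have x0 j : 0 <= x j by rewrite mulr_ge0 // exprn_ge0 // ltW.
(* Induction on the truncation length: the first n + 1 terms call the recursion on the first n only,
   whose convolution is at most the square of their sum. As z Q = 1/h, inserting the bound Q s gives
   Q times the supersolution inequality. *)
have S n : \sum_(0 <= j < n) x j <= Q * s.
  elim: n => [|n IH]; first by rewrite big_geq // mulr_ge0 // ltW.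
  rewrite big_nat_recl //= {1}/x expr0 mulr1.
  have hx j : x j.+1 <= z * (Q * a) * x j
      + z * b * \sum_(0 <= p < j.+1) x (j - p)%N * x p.
    have -> : \sum_(0 <= p < j.+1) x (j - p)%N * x p
        = z ^+ j * \sum_(0 <= p < j.+1) T (j - p)%N * T p.
      rewrite mulr_sumr !big_nat; apply: eq_bigr => p /andP[_ pj].
      have <- : z ^+ (j - p) * z ^+ p = z ^+ j by rewrite -exprD subnK.
      by rewrite /x; ring.
    have := ler_wpM2r (exprn_ge0 j.+1 (ltW z0)) (hT j).
    rewrite /x exprS => /le_trans; apply.
    by rewrite le_eqVlt; apply/orP; left; apply/eqP; ring.
  apply: le_trans (lerD hT0 (ler_sum _ (fun j _ => hx j))) _.
  rewrite big_split /= -!mulr_sumr.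
  set X := \sum_(0 <= i < n) x i in IH *.
  have X0 : 0 <= X by exact: sum_nat_ge0.
  have h2 := sum_conv_le n x0.
  have h3 : X ^+ 2 <= (Q * s) ^+ 2 by rewrite ler_sqr // nnegrE // mulr_ge0 // ltW.
  have zb : 0 <= z * b by rewrite mulr_ge0 // ltW.
  have za : 0 <= z * (Q * a) by rewrite !mulr_ge0 // ltW.
  have h4 := ler_wpM2l zb (le_trans h2 h3).
  have h5 := ler_wpM2l za IH.
  have h6 := ler_wpM2l (ltW Q0) hs.
  apply: le_trans h6; rewrite mulrDr lerD2l.
  apply: le_trans (lerD h5 h4) _.
  rewrite le_eqVlt; apply/orP; left; apply/eqP; rewrite /z.
  by field; rewrite !gt_eqF.
move=> j.
have : x j <= Q * s.
  apply: le_trans (S j.+1).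
  by rewrite big_nat_recr //= lerDr sum_nat_ge0.
by rewrite /x /z exprVn ler_pdivrMr ?exprn_gt0.
Qed.

Lemma bernoulli (d : R) n : 0 <= d -> 1 + n%:R * d <= (1 + d) ^+ n.
Proof.
move=> d0; elim: n => [|n IH]; first by rewrite mul0r addr0 expr0.
rewrite exprS -natr1.
have /ler_wpM2l/(_ _ _ IH) : 0 <= 1 + d by lra.
apply: le_trans.
have : 0 <= n%:R * (d * d) by rewrite !mulr_ge0.
by lra.
Qed.

Lemma sqr_geometric_bound (t : R) : 0 <= t < 1 ->
  exists2 K, 0 < K & forall m : nat, m.+1%:R ^+ 2 * t ^+ m <= K.
Proof.
(* With t = 1 - 3d one has (1+d)^2 t <= 1, and d <= 1 turns Bernoulli into d (m+1) <= (1+d)^m.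
   Squaring gives the bound with K = 1/d^2. *)
move=> /andP[t0 t1]; pose d := (1 - t) / 3.
have d0 : 0 < d by rewrite /d; lra.
have d1 : d <= 1 by rewrite /d; lra.
have dt : (1 + d) ^+ 2 * t <= 1 by rewrite /d; nra.
clearbody d; exists (d ^- 2); first by rewrite invr_gt0 exprn_gt0.
move=> m; rewrite -[leRHS]mul1r ler_pdivlMr ?exprn_gt0 //.
have h1 : d * m.+1%:R <= (1 + d) ^+ m.
  apply: le_trans (bernoulli m (ltW d0)).
  by rewrite -natr1 mulrDr mulr1 addrC mulrC lerD2r.
have h2 : ((1 + d) ^+ 2 * t) ^+ m <= 1.
  by apply: exprn_ile1 => //; rewrite mulr_ge0 // sqr_ge0.
apply: le_trans h2; rewrite exprMn -exprM mulnC exprM mulrAC ler_wpM2r ?exprn_ge0 //.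
rewrite -exprMn mulrC ler_sqr // nnegrE ?mulr_ge0 ?exprn_ge0 // ?ltW //.
by lra.
Qed.

Lemma cvg_natM_geometric (t : R) : 0 <= t < 1 ->
  (fun m : nat => m%:R * t ^+ m) @ \oo --> (0 : R).
Proof.
move=> /[dup] /andP[t0 _] /sqr_geometric_bound[K K0 hK].
have hc : (fun m : nat => K * (m.+1%:R)^-1) @ \oo --> (0 : R).
  by rewrite -(mulr0 K); apply: cvgM; [exact: cvg_cst | exact: cvg_harmonic].
apply: (squeeze_cvgr _ (cvg_cst 0) hc).
apply: nearW => m; rewrite mulr_ge0 ?exprn_ge0 //=.
rewrite ler_pdivlMr // ; apply: le_trans (hK m).
rewrite expr2 mulrAC ler_wpM2r ?exprn_ge0 // ler_wpM2r //.
by rewrite ler_nat.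
Qed.

Lemma cvg_geometric_dist (a : nat -> R) (l A r : R) : 0 <= r < 1 ->
  (forall m, `|l - a m| <= A * r ^+ m) -> a @ \oo --> l.
Proof.
move=> /andP[r0 r1] ha.
have cr : (fun m => A * r ^+ m) @ \oo --> (0 : R).
  rewrite -(mulr0 A); apply: cvgM; first exact: cvg_cst.
  by apply: cvg_expr; rewrite ger0_norm.
apply/cvgrPdist_lt => e e0.
have [N _ hN] : \forall m \near \oo, `|0 - A * r ^+ m| < e.
  by move/cvgrPdist_lt : cr; apply.
exists N => // n Nn; apply: le_lt_trans (ha n) _.
by apply: le_lt_trans (hN n Nn); rewrite sub0r normrN ler_norm.
Qed.

Lemma geometric_tail (a : nat -> R) (A r : R) : 0 <= A -> 0 <= r < 1 ->
  (forall j, `|a j| <= A * r ^+ j) ->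
  exists l, forall m, `|l - \sum_(0 <= j < m) a j| <= A / (1 - r) * r ^+ m.
Proof.
move=> A0 /andP[r0 r1] ha.
have r1' : 0 < 1 - r by lra.
pose S m := \sum_(0 <= j < m) a j.
(* The subtracted power is kept because the right-hand side is then the exact sum of the geometric
   block, which closes the induction on [n]. *)
have inc m n : `|S (m + n)%N - S m| <= A / (1 - r) * (r ^+ m - r ^+ (m + n)).
  elim: n => [|n IH]; first by rewrite addn0 !subrr normr0 mulr0.
  rewrite addnS /S big_nat_recr //= -/(S _).
  have -> : S (m + n)%N + a (m + n)%N - S m
    = (S (m + n)%N - S m) + a (m + n)%N by ring.
  apply: le_trans (ler_normD _ _) _; apply: le_trans (lerD IH (ha _)) _.
  rewrite exprS le_eqVlt; apply/orP; left; apply/eqP.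
  by field; rewrite gt_eqF.
have inc' m n : (m <= n)%N -> `|S n - S m| <= A / (1 - r) * r ^+ m.
  move=> mn; rewrite -(subnKC mn); apply: le_trans (inc m _) _.
  rewrite ler_wpM2l ?divr_ge0 ?(ltW r1') //.
  by rewrite gerBl exprn_ge0.
have cr : (fun m => A / (1 - r) * r ^+ m) @ \oo --> (0 : R).
  rewrite -(mulr0 (A / (1 - r))); apply: cvgM; first exact: cvg_cst.
  by apply: cvg_expr; rewrite ger0_norm.
have cv : cvg (S @ \oo).
  apply/cauchy_cvgP/cauchy_exP => e e0.
  have [N _ hN] : \forall m \near \oo, `|0 - A / (1 - r) * r ^+ m| < e.
    by move/cvgrPdist_lt : cr; apply.
  exists (S N), N => // n /= Nn.
  rewrite /ball /= distrC; apply: le_lt_trans (inc' _ _ Nn) _.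
  by apply: le_lt_trans (hN N (leqnn N)); rewrite sub0r normrN ler_norm.
exists (lim (S @ \oo)) => m.
have cn : (fun n => `|S n - S m|) @ \oo --> `|lim (S @ \oo) - S m|.
  by apply: cvg_norm; apply: cvgB => //; exact: cvg_cst.
by apply: (cvgr_to_le cn); exists m => // n /= mn; exact: inc'.
Qed.

Lemma psumE (a : nat -> R) m : psum a m = a 0%N + \sum_(0 <= j < m) a j.+1.
Proof. by rewrite /psum big_ord_recl big_mkord. Qed.

(** Stage [h n] is a table correct up to index n: stage n + 1 keeps the entries up to n and fills
    all others with the new value. Entries never change afterwards, so the diagonal is the required
    sequence. *)
Lemma strong_recursion (X : Type) (x0 : X) (F : nat -> (nat -> X) -> X) :
  (forall j f g, (forall i, (i <= j)%N -> f i = g i) -> F j f = F j g) ->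
  exists f, f 0%N = x0 /\ forall j, f j.+1 = F j f.
Proof.
move=> hF.
pose h := fix h n : nat -> X := if n is m.+1 then
  (fun i => if (i <= m)%N then h m i else F m (h m)) else (fun=> x0).
have stable n i : (i <= n)%N -> h n i = h i i.
  elim: n => [|n IH]; first by rewrite leqn0 => /eqP ->.
  rewrite leq_eqVlt => /predU1P[-> //|].
  by rewrite ltnS => le_in /=; rewrite le_in IH.
exists (fun i => h i i); split => // j.
rewrite /= ltnn; apply: hF => i ij; exact: stable.
Qed.

End Sequences.

(** * The correction equations on [0,1] *)

Section Corrections.
Variable R : realType.
Variables (q : R -> R) (hq : L1on q 0 1) (k : R) (k0 : 0 < k).
Variables (v : R -> R) (hv : bdm 0 1 v) (B d : R).
Hypothesis hB : forall x, 0 <= x <= 1 -> `|v x| <= B.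
Hypothesis d0 : 0 < d.
Let D := Rint (fun t => sin (k * (1 - t)) * v t) 0 1.
Hypothesis hD : d <= `|D|.
Let Q := normL1 q.

(** The problem glued over [0,1]: corrections have no jumps at 1/2, so the interface conditions
    disappear. The trial function is prescribed without an equation, since its own derivative does
    jump. *)
Definition corrections (lam : nat -> R) (u du : nat -> R -> R) :=
  lam 0%N = k ^+ 2 /\ (forall x, 0 <= x <= 1 -> u 0%N x = v x) /\
  forall j, sol_on 0 1 (u j.+1) (du j.+1)
      (fun x => FDrhs q lam u j x - k ^+ 2 * u j.+1 x) /\
    [/\ u j.+1 0 = 0, u j.+1 1 = 0 & du j.+1 0 = 0].

(* The part of the right-hand side that does not involve the unknown
   [lam j.+1]. *)
Definition known_rhs (lam : nat -> R) (u : nat -> R -> R) (j : nat) (x : R) : R :=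
  q x * u j x - \sum_(1 <= p < j.+1) lam (j.+1 - p)%N * u p x.

Lemma FDrhsE lam u j x : FDrhs q lam u j x = known_rhs lam u j x - lam j.+1 * u 0%N x.
Proof. by rewrite /FDrhs /known_rhs big_ltn // subn0; ring. Qed.

Lemma L1on_known_rhs lam u j : (forall p, (p <= j)%N -> bdm 0 1 (u p)) ->
  L1on (known_rhs lam u j) 0 1.
Proof.
move=> hu; apply: L1onB.
  have := L1onM_bdm (hu j (leqnn j)) hq.
  by apply: eq_L1on => x _; rewrite mulrC.
apply/bdm_L1on/bdm_sum => p /andP[_ pj]; apply: bdmZ; exact: hu.
Qed.

Lemma Q_ge0 : 0 <= Q.
Proof. by apply: Rint_ge0 => x _. Qed.

(** [q] is controlled only through its integral and contributes [m] times its L1 norm; the rest is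
    bounded pointwise on an interval of length at most 1. The later integral estimates for the
    corrections are instances. *)
Lemma Rint_potential_bound (f : R -> R) m c x : L1on f 0 1 -> 0 <= m -> 0 <= c ->
  (forall t, 0 <= t <= 1 -> `|f t| <= `|q t| * m + c) -> 0 <= x <= 1 ->
  `|Rint f 0 x| <= Q * m + c.
Proof.
move=> hf m0 c0 hfb /andP[x0 x1].
have Lq : L1on (fun t => `|q t| * m + c) 0 1.
  apply: L1onD; last exact: L1on_cst.
  by have := L1onZ m (L1on_abs hq); apply: eq_L1on => t _; rewrite mulrC.
have hf' : L1on f 0 x by apply: (L1onS hf).
have Lq' : L1on (fun t => `|q t| * m + c) 0 x by apply: (L1onS Lq).
apply: (@le_trans _ _ (Rint (fun t => `|q t| * m + c) 0 x)).
  apply: Rint_le_norm => // t /andP[t0 tx]; apply: hfb.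
  by rewrite t0 (le_trans tx).
apply: (@le_trans _ _ (Rint (fun t => `|q t| * m + c) 0 1)).
  by apply: (Rint_le_sub Lq) => // t _; rewrite addr_ge0 // mulr_ge0.
have Lqm : L1on (fun t => m * `|q t|) 0 1 by apply: L1onZ; exact: L1on_abs.
have -> : Rint (fun t => `|q t| * m + c) 0 1
    = Rint (fun t => m * `|q t|) 0 1 + Rint (fun=> c) 0 1.
  rewrite -(RintD Lqm (L1on_cst _ _ _)).
  by apply: eq_Rint => t _; rewrite mulrC.
rewrite Rint_cst // RintZ; last exact: L1on_abs.
by rewrite subr0 mulr1 mulrC.
Qed.

Lemma corrections_exist : exists lam u du, corrections lam u du.
Proof.
have Dn0 : D != 0 by rewrite -normr_gt0 (lt_le_trans d0).
pose X := (R * (R -> R) * (R -> R))%type.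
pose la (f : nat -> X) i := (f i).1.1.
pose fu (f : nat -> X) i := (f i).1.2.
(* This choice of the new eigenvalue correction is the one that gives u^(j+1)(1) = 0. *)
pose nl j f := Rint (fun t => sin (k * (1 - t)) * known_rhs (la f) (fu f) j t) 0 1 / D.
pose phi j f t := known_rhs (la f) (fu f) j t - nl j f * fu f 0%N t.
pose step j f : X := (nl j f,
  (fun x => Rint (fun t => sin (k * (x - t)) * phi j f t) 0 x / k),
  (fun x => Rint (fun t => cos (k * (x - t)) * phi j f t) 0 x)).
(* The derivative entry at index 0 is a placeholder: [corrections] speaks only of [du j.+1]. *)
have [|f [f0 fS]] := @strong_recursion X (k ^+ 2, v, fun=> 0) step.
  move=> j f g fg.
  have known : known_rhs (la f) (fu f) j = known_rhs (la g) (fu g) j.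
    apply: funext => x; rewrite /known_rhs /la /fu fg //; congr (_ - _).
    rewrite !big_nat; apply: eq_bigr => p /andP[p1 pj].
    by rewrite !fg // subSn // ltn_subLR // -add1n leq_add.
  have nlE : nl j f = nl j g by rewrite /nl known.
  have phiE : phi j f = phi j g.
    by apply: funext => x; rewrite /phi known nlE /fu fg.
  by rewrite /step nlE phiE.
exists (la f), (fu f), (fun i => (f i).2).
have main j : (forall p, (p <= j)%N -> bdm 0 1 (fu f p)) ->
   sol_on 0 1 (fu f j.+1) (f j.+1).2
      (fun x => FDrhs q (la f) (fu f) j x - k ^+ 2 * fu f j.+1 x) /\
    [/\ fu f j.+1 0 = 0, fu f j.+1 1 = 0 & (f j.+1).2 0 = 0].
  move=> hu.
  have LG := L1on_known_rhs (la f) hu.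
  have hu0 : L1on (fu f 0%N) 0 1 by apply: bdm_L1on; exact: hu.
  have Lphi : L1on (phi j f) 0 1 by apply: L1onB => //; exact: L1onZ.
  have rhsE x : FDrhs q (la f) (fu f) j x = phi j f x.
    by rewrite FDrhsE /phi {2}/la fS.
  rewrite /fu fS /=; split.
    have /sol_onE[h1 h2] := oscillator_sol ler01 (lt0r_neq0 k0) Lphi.
    apply/sol_onE; split => //; apply: eq_prim h2 => // x _.
    by rewrite -/(fu f) rhsE.
  split; [by rewrite Rint_point mul0r | | by rewrite Rint_point].
  have Lw F : L1on F 0 1 -> L1on (fun t => sin (k * (1 - t)) * F t) 0 1.
    by apply: L1onM_bdm; exact: bdm_sinB.
  have -> : Rint (fun t => sin (k * (1 - t)) * phi j f t) 0 1
     = Rint (fun t => sin (k * (1 - t)) * known_rhs (la f) (fu f) j t) 0 1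
       - nl j f * D.
    have -> : D = Rint (fun t => sin (k * (1 - t)) * fu f 0%N t) 0 1.
      by rewrite /D /fu f0.
    rewrite -(RintZ _ (Lw _ hu0)) -(RintB (Lw _ LG) (L1onZ _ (Lw _ hu0))).
    by apply: eq_Rint => t _; rewrite /phi; ring.
  by rewrite /nl divfK // subrr mul0r.
have hbd : forall n p, (p <= n)%N -> bdm 0 1 (fu f p).
  elim=> [|n IH] p.
    by rewrite leqn0 => /eqP ->; rewrite /fu f0.
  rewrite leq_eqVlt => /predU1P[->|]; last exact: IH.
  have [/sol_onE[h _] _] := main n IH.
  exact: prim_bdm h.
split; first by rewrite /la f0.
split; first by move=> x _; rewrite /fu f0.
by move=> j; apply: main => p; exact: hbd.
Qed.

Section Estimates.
Variables (lam : nat -> R) (u du : nat -> R -> R).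
Hypothesis hc : corrections lam u du.

Lemma corrections_bdm j : bdm 0 1 (u j).
Proof.
have [_ [hu0 hS]] := hc; case: j => [|j].
  by apply: eq_bdm hv => x /hu0.
have [/sol_onE[h _] _] := hS j.
exact: prim_bdm h.
Qed.

Lemma L1on_FDrhs j : L1on (FDrhs q lam u j) 0 1.
Proof.
have h1 := L1on_known_rhs lam (fun p (_ : (p <= j)%N) => corrections_bdm p).
have h2 := L1onZ (lam j.+1) (bdm_L1on (corrections_bdm 0)).
by apply: eq_L1on (L1onB h1 h2) => x _; rewrite FDrhsE.
Qed.

Lemma corrections_repr j x : 0 <= x <= 1 ->
  k * u j.+1 x = Rint (fun t => sin (k * (x - t)) * FDrhs q lam u j t) 0 x.
Proof.
have [_ [hu0 /(_ j)[hS [u0 _ du0]]]] := hc.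
exact: (oscillator_repr ler01 (L1on_FDrhs j) hS u0 du0).
Qed.

(** The solvability condition: the representation at x = 1, where u^(j+1) vanishes, with the term in
    lam^(j+1) split off. *)
Lemma corrections_lam j :
  lam j.+1 * D = Rint (fun t => sin (k * (1 - t)) * known_rhs lam u j t) 0 1.
Proof.
have [_ [hu0 /(_ j)[hS [_ u1 _]]]] := hc.
have := @corrections_repr j 1; rewrite ler01 lexx u1 mulr0 => /(_ isT).
have Lk := L1on_known_rhs lam (fun p (_ : (p <= j)%N) => corrections_bdm p).
have Lw F : L1on F 0 1 -> L1on (fun t => sin (k * (1 - t)) * F t) 0 1.
  by apply: L1onM_bdm; exact: bdm_sinB.
have Lv := Lw _ (bdm_L1on hv).
have -> : Rint (fun t => sin (k * (1 - t)) * FDrhs q lam u j t) 0 1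
   = Rint (fun t => sin (k * (1 - t)) * known_rhs lam u j t) 0 1 - lam j.+1 * D.
  rewrite -(RintZ _ Lv) -(RintB (Lw _ Lk) (L1onZ _ Lv)).
  by apply: eq_Rint => t /hu0 ut; rewrite FDrhsE ut; ring.
by move/esym/eqP; rewrite subr_eq0 => /eqP ->.
Qed.

Definition supnorm (f : R -> R) := sup [set `|f x| | x in `[0, 1]].

Lemma le_supnorm f x : bdm 0 1 f -> 0 <= x <= 1 -> `|f x| <= supnorm f.
Proof.
move=> [_ [C hC]] x01; apply: ub_le_sup; last first.
  by exists x => //=; rewrite in_itv.
by exists C => _ [y /= + <-]; rewrite in_itv /=; exact: hC.
Qed.

Lemma supnorm_le f C : (forall x, 0 <= x <= 1 -> `|f x| <= C) -> supnorm f <= C.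
Proof.
move=> hC; apply: ge_sup.
  by exists `|f 0|, 0 => //=; rewrite in_itv /= lexx ler01.
by move=> _ [y /= + <-]; rewrite in_itv /=; exact: hC.
Qed.

Lemma supnorm_ge0 f : bdm 0 1 f -> 0 <= supnorm f.
Proof.
move=> hf; apply: le_trans (normr_ge0 (f 0)) _.
by apply: le_supnorm => //; rewrite lexx ler01.
Qed.

Let M j := supnorm (u j).
Let T j := Q * M j + \sum_(1 <= p < j.+1) `|lam (j.+1 - p)%N| * M p.
(** The 1 accounts for the known part of the right-hand side, B/d for the term lam^(j+1) u^(0). *)
Let kap := 1 + B / d.

Let M0 j : 0 <= M j. Proof. exact/supnorm_ge0/corrections_bdm. Qed.

Let S0 j : 0 <= \sum_(1 <= p < j.+1) `|lam (j.+1 - p)%N| * M p.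
Proof. by apply: sumr_ge0 => p _; rewrite mulr_ge0. Qed.

Let T0 j : 0 <= T j.
Proof. by rewrite addr_ge0 // mulr_ge0 // Q_ge0. Qed.

Let B0 : 0 <= B.
Proof. by apply: le_trans (normr_ge0 (v 0)) (hB _); rewrite lexx ler01. Qed.

Let kap0 : 0 < kap.
Proof. by rewrite ltr_pwDl // divr_ge0 // ltW. Qed.

Lemma known_rhs_bound j t : 0 <= t <= 1 ->
  `|known_rhs lam u j t|
    <= `|q t| * M j + \sum_(1 <= p < j.+1) `|lam (j.+1 - p)%N| * M p.
Proof.
move=> t01; apply: le_trans (ler_normB _ _) _; apply: lerD.
  by rewrite normrM ler_wpM2l //; exact: le_supnorm (corrections_bdm j) t01.
apply: le_trans (ler_norm_sum _ _ _) _; apply: ler_sum => p _.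
by rewrite normrM ler_wpM2l //; exact: le_supnorm (corrections_bdm p) t01.
Qed.

Lemma lam_bound j : `|lam j.+1| <= T j / d.
Proof.
rewrite ler_pdivlMr //.
apply: (@le_trans _ _ `|lam j.+1 * D|); first by rewrite normrM ler_wpM2l.
rewrite corrections_lam; apply: Rint_potential_bound => //; last by rewrite ler01 lexx.
  apply: L1onM_bdm; first exact: bdm_sinB.
  exact: L1on_known_rhs (fun p _ => corrections_bdm p).
move=> t t01; rewrite normrM; apply: le_trans (known_rhs_bound j t01).
by rewrite -[leRHS]mul1r ler_wpM2r // sin_abs_le1.
Qed.

Lemma u_bound j : M j.+1 <= kap / k * T j.
Proof.
apply: supnorm_le => x /[dup] x01 /andP[x0 x1].
have -> : kap / k * T j = kap * T j / k by ring.
rewrite ler_pdivlMr // mulrC.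
have -> : k * `|u j.+1 x| = `|k * u j.+1 x| by rewrite normrM gtr0_norm.
rewrite corrections_repr //.
have hl := lam_bound j.
set s := \sum_(1 <= p < j.+1) `|lam (j.+1 - p)%N| * M p.
apply: (@le_trans _ _ (Q * M j + (s + `|lam j.+1| * B))).
  have Lf : L1on (fun t => sin (k * (x - t)) * FDrhs q lam u j t) 0 1.
    by apply: L1onM_bdm (L1on_FDrhs j); exact: bdm_sinB.
  apply: Rint_potential_bound => //.
    by rewrite addr_ge0 ?S0 // mulr_ge0.
  move=> t t01; rewrite normrM.
  apply: (@le_trans _ _ `|FDrhs q lam u j t|).
    by rewrite -[leRHS]mul1r ler_wpM2r // sin_abs_le1.
  rewrite FDrhsE; apply: le_trans (ler_normB _ _) _; rewrite addrA.
  apply: lerD; first exact: known_rhs_bound.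
  have [_ [hu0 _]] := hc.
  by rewrite normrM ler_wpM2l // hu0 // hB.
rewrite addrA -/(T j) /kap mulrDl mul1r lerD2l.
have -> : B / d * T j = T j / d * B by ring.
exact: ler_wpM2r.
Qed.

Variables (h s : R).
Hypothesis h0 : 0 < h.
Hypothesis s0 : 0 <= s.
Hypothesis super : B + (kap / k * s + kap / (k * d) * s ^+ 2) / h <= s.

Lemma T_bound j : T j <= Q * s * (Q * h) ^+ j.
Proof.
apply: (@quadratic_majorant _ T Q B (kap / k) (kap / (k * d))) => //.
- exact: Q_ge0.
- by rewrite divr_ge0 // ltW.
- by rewrite divr_ge0 ?mulr_ge0 // ltW.
- rewrite /T big_geq // addr0 ler_wpM2l ?Q_ge0 //.
  by have [_ [hu0 _]] := hc; apply: supnorm_le => x /[dup] x01 /hu0 ->; exact: hB.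
- move=> i; rewrite /T -/(T i); apply: lerD.
    by rewrite -mulrA ler_wpM2l ?Q_ge0 // u_bound.
  (* After the shift both factors have positive indices, |lam^(i-p+1)| and M_(p+1), because the term
     p = 0 is outside [known_rhs]. So [lam_bound] and [u_bound] apply, and their constants multiply
     to kap/(k d). *)
  rewrite big_add1 /= mulr_sumr !big_nat; apply: ler_sum => p /andP[_ pi].
  have -> : (i.+2 - p.+1 = (i - p).+1)%N by rewrite subSS subSn.
  have -> : kap / (k * d) * (T (i - p)%N * T p) = (T (i - p)%N / d) * (kap / k * T p).
    by field; rewrite !gt_eqF.
  by apply: ler_pM => //; [exact: lam_bound | exact: u_bound].
Qed.

Lemma lam_geometric j : `|lam j.+1| <= Q * (s / d) * (Q * h) ^+ j.
Proof.
apply: le_trans (lam_bound j) _; rewrite ler_pdivrMr //.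
apply: le_trans (T_bound j) _; rewrite le_eqVlt; apply/orP; left; apply/eqP.
by field; rewrite gt_eqF.
Qed.

Lemma u_geometric j x : 0 <= x <= 1 ->
  `|u j.+1 x| <= Q * (kap / k * s) * (Q * h) ^+ j.
Proof.
move=> x01; apply: le_trans (le_supnorm (corrections_bdm _) x01) _.
apply: le_trans (u_bound j) _.
have kk : 0 <= kap / k by rewrite divr_ge0 // ltW.
apply: le_trans (ler_wpM2l kk (T_bound j)) _.
by rewrite le_eqVlt; apply/orP; left; apply/eqP; ring.
Qed.


(** [W] is the sum of the corrections alone: it solves an equation on all of [0,1], whereas the
    trial function has a kink at 1/2. The right-hand side is arranged so that adding v'' = - k^2 v
    on either half turns v + W into an eigenfunction for [L]. *)
Lemma corrections_limit (A1 A2 r : R) : 0 <= r < 1 -> 0 <= A1 -> 0 <= A2 ->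
  (forall j, `|lam j.+1| <= A1 * r ^+ j) ->
  (forall j x, 0 <= x <= 1 -> `|u j.+1 x| <= A2 * r ^+ j) ->
  exists L W dW,
    [/\ sol_on 0 1 W dW (fun x => (q x - L) * (v x + W x) + k ^+ 2 * v x),
      [/\ W 0 = 0, W 1 = 0 & dW 0 = 0],
      forall m, `|L - psum lam m| <= A1 / (1 - r) * r ^+ m &
      forall x, 0 <= x <= 1 -> forall m,
        `|v x + W x - psum (fun j => u j x) m| <= A2 / (1 - r) * r ^+ m].
Proof.
move=> r01 A10 A20 hlam hu; have /andP[r0 r1] := r01.
have [lam0 [u0 hS]] := hc.
have C20 : 0 <= A2 / (1 - r) by rewrite divr_ge0 //; lra.
have C10 : 0 <= A1 / (1 - r) by rewrite divr_ge0 //; lra.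
have [l hl] := geometric_tail A10 r01 hlam.
pose Wm m x := \sum_(0 <= j < m) u j.+1 x.
pose W x := lim ((fun m => Wm m x) @ \oo).
have hW x : 0 <= x <= 1 -> forall m, `|W x - Wm m x| <= A2 / (1 - r) * r ^+ m.
  move=> x01; have [w hw] := geometric_tail A20 r01 (fun j => hu j x x01).
  by have -> : W x = w by apply: cvg_lim => //; exact: cvg_geometric_dist hw.
have bWm m : bdm 0 1 (Wm m) by apply: bdm_sum => i _; exact: corrections_bdm.
have bW : bdm 0 1 W.
  split.
    apply: (measurable_fun_cvg (h := Wm)) => [m|x /=]; first exact: (bWm m).1.
    by rewrite in_itv /= => x01; exact: cvg_geometric_dist (hW x x01).
  exists (A2 / (1 - r)) => x x01; have := hW x x01 0%N.
  by rewrite /Wm big_geq // subr0 mulr1.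
pose L := k ^+ 2 + l.
have bU : bdm 0 1 (fun x => v x + W x) by exact: bdmD.
pose g x := (q x - L) * (v x + W x) + k ^+ 2 * v x.
have Lg : L1on g 0 1.
  have := L1onD (L1onB (L1onM_bdm bU hq) (L1onZ L (bdm_L1on bU)))
    (L1onZ (k ^+ 2) (bdm_L1on hv)).
  by apply: eq_L1on => x _; rewrite /g; ring.
(* With the derivative defined from the limit equation, the second-order relation holds by
   construction; what remains is to identify [W] with the integral of [dW] by passing to the
   limit. *)
pose dW x := Rint g 0 x.
pose gm m t := \sum_(0 <= j < m) (FDrhs q lam u j t - k ^+ 2 * u j.+1 t).
pose dWm m x := \sum_(0 <= j < m) du j.+1 x.
have pWm m : prim 0 1 (Wm m) (dWm m).
  by apply: (prim_sum (f := fun j => u j.+1)) => j; have [/sol_onE[]] := hS j.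
have pdWm m : prim 0 1 (dWm m) (gm m).
  apply: (prim_sum (f := fun j => du j.+1)
    (df := fun j x => FDrhs q lam u j x - k ^+ 2 * u j.+1 x)) => j.
  by have [/sol_onE[]] := hS j.
have Wm0 m : Wm m 0 = 0 by apply: big1 => j _; have [_ []] := hS j.
have Wm1 m : Wm m 1 = 0 by apply: big1 => j _; have [_ []] := hS j.
have dWm0 m : dWm m 0 = 0 by apply: big1 => j _; have [_ []] := hS j.
have W01 x : 0 <= x <= 1 -> (forall m, Wm m x = 0) -> W x = 0.
  move=> x01 Wx0; apply: cvg_lim => //.
  by rewrite (_ : (fun m => Wm m x) = (fun=> 0)); [exact: cvg_cst | exact/funext].
pose Lam i := \sum_(0 <= j < i) lam j.+1.
(* Summed over j, the convolutions regroup by the index of u: u^(p) meets the partial sum [Lam] of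
   length m - p, which tends to [l]. *)
have gmE m t : gm m t = q t * \sum_(0 <= j < m) u j t
    - \sum_(0 <= p < m) u p t * Lam (m - p)%N - k ^+ 2 * Wm m t.
  rewrite /gm sumrB -mulr_sumr; congr (_ - _).
  have -> : \sum_(0 <= p < m) u p t * Lam (m - p)%N
     = \sum_(0 <= p < m) \sum_(0 <= i < m - p) lam i.+1 * u p t.
    by apply: eq_bigr => p _; rewrite mulrC /Lam mulr_suml.
  rewrite -(sum_triangle (fun p i => lam i.+1 * u p t)) mulr_sumr -sumrB.
  apply: eq_bigr => j _; rewrite /FDrhs addrC; congr (_ - _).
  by rewrite !big_nat; apply: eq_bigr => p /andP[_ pj]; rewrite subSn.
(* The remainder of the limit equation apart from the [q]-term: l times the tail of u, the Cauchy
   product, and k^2 times the tail of u. In the Cauchy product p = 0 is bounded through [B], and the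
   n products of size r^p r^(n-p) produce the factor n. *)
pose c n := `|l| * (A2 / (1 - r) * r ^+ n)
  + (B * (A1 / (1 - r) * r ^+ n) + A2 * (A1 / (1 - r)) * (n%:R * r ^+ n))
  + k ^+ 2 * (A2 / (1 - r) * r ^+ n).
have rS n : r ^+ n.+1 <= r ^+ n by rewrite exprS ler_piMl ?exprn_ge0 // ltW.
have gdist n t : 0 <= t <= 1 ->
    `|g t - gm n.+1 t| <= `|q t| * (A2 / (1 - r) * r ^+ n) + c n.
  move=> t01.
  have eU : v t + W t - \sum_(0 <= j < n.+1) u j t = W t - Wm n t.
    by rewrite big_nat_recl //= u0 // /Wm; ring.
  have -> : g t - gm n.+1 t = q t * (W t - Wm n t) - (l * (W t - Wm n t)
      + \sum_(0 <= p < n.+1) u p t * (l - Lam (n.+1 - p)%N)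
      + k ^+ 2 * (W t - Wm n.+1 t)).
    have -> : \sum_(0 <= p < n.+1) u p t * (l - Lam (n.+1 - p)%N)
       = l * \sum_(0 <= p < n.+1) u p t
         - \sum_(0 <= p < n.+1) u p t * Lam (n.+1 - p)%N.
      by rewrite mulr_sumr -sumrB; apply: eq_bigr => p _; ring.
    by rewrite -eU gmE /g /L; ring.
  apply: le_trans (ler_normB _ _) _; apply: lerD.
    by rewrite normrM ler_wpM2l // hW.
  apply: le_trans (ler_normD _ _) _; apply: lerD; last first.
    rewrite normrM ger0_norm ?sqr_ge0 // ler_wpM2l ?sqr_ge0 //.
    by apply: le_trans (hW t t01 _) _; rewrite ler_wpM2l.
  apply: le_trans (ler_normD _ _) _; apply: lerD.
    by rewrite normrM ler_wpM2l // hW.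
  rewrite big_nat_recl //=; apply: le_trans (ler_normD _ _) _; apply: lerD.
    rewrite normrM u0 // subn0; apply: ler_pM => //; first exact: hB.
    by apply: le_trans (hl n.+1) _; rewrite ler_wpM2l.
  apply: le_trans (ler_norm_sum _ _ _) _.
  apply: (@le_trans _ _ (\sum_(0 <= p < n) A2 * (A1 / (1 - r)) * r ^+ n)).
    rewrite !big_nat; apply: ler_sum => p /andP[_ pn].
    rewrite normrM subSS.
    have -> : A2 * (A1 / (1 - r)) * r ^+ n
        = (A2 * r ^+ p) * (A1 / (1 - r) * r ^+ (n - p)).
      by rewrite -[in LHS](subnKC (ltnW pn)) exprD; ring.
    by apply: ler_pM => //; [exact: hu | exact: hl].
  rewrite big_const_nat iter_addr_0 subn0 -mulr_natl.
  by rewrite le_eqVlt; apply/orP; left; apply/eqP; ring.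
have c0 n : 0 <= c n.
  have rn : 0 <= r ^+ n by exact: exprn_ge0.
  by rewrite /c; do ?[exact: sqr_ge0|done|apply: addr_ge0|apply: mulr_ge0].
have pdW : prim 0 1 dW g := prim_Rint Lg.
have ddist n x : 0 <= x <= 1 ->
    `|dW x - dWm n.+1 x| <= Q * (A2 / (1 - r) * r ^+ n) + c n.
  move=> /[dup] x01 /andP[x0 x1].
  rewrite ((pdWm n.+1).2 x x01) dWm0 add0r /dW.
  have L1 : L1on g 0 x by apply: (L1onS Lg).
  have L2 : L1on (gm n.+1) 0 x by apply: (L1onS (pdWm n.+1).1).
  rewrite -RintB //; apply: Rint_potential_bound => //.
  - by apply: L1onB => //; exact: (pdWm n.+1).1.
  - by rewrite mulr_ge0 ?exprn_ge0.
  - exact: gdist.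
have LdW : L1on dW 0 1 by apply: bdm_L1on; exact: prim_bdm pdW.
exists L, W, dW; split; last 2 first.
- move=> m; rewrite psumE lam0.
  have -> : L - (k ^+ 2 + \sum_(0 <= j < m) lam j.+1)
      = l - \sum_(0 <= j < m) lam j.+1 by rewrite /L; ring.
  exact: hl.
- move=> x x01 m; rewrite psumE u0 //.
  have -> : v x + W x - (v x + \sum_(0 <= j < m) u j.+1 x) = W x - Wm m x.
    by rewrite /Wm; ring.
  exact: hW.
- apply/sol_onE; split; last exact: pdW.
  split=> // x /[dup] x01 /andP[x0 x1].
  have W0 : W 0 = 0 by apply: W01 => //; rewrite lexx ler01.
  pose e n := A2 / (1 - r) * r ^+ n + (Q * (A2 / (1 - r) * r ^+ n) + c n).
  have He n : `|W x - Rint dW 0 x| <= e n.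
    have L1 : L1on dW 0 x by apply: (L1onS LdW).
    have L2 : L1on (dWm n.+1) 0 x by apply: (L1onS (pWm n.+1).1).
    have -> : W x - Rint dW 0 x = (W x - Wm n.+1 x) - (Rint dW 0 x - Wm n.+1 x) by ring.
    apply: le_trans (ler_normB _ _) _; apply: lerD.
      by apply: le_trans (hW x x01 _) _; rewrite ler_wpM2l.
    rewrite [Wm n.+1 x]((pWm n.+1).2 x x01) Wm0 add0r -RintB //.
    have -> : Q * (A2 / (1 - r) * r ^+ n) + c n
        = Q * 0 + (Q * (A2 / (1 - r) * r ^+ n) + c n) by rewrite mulr0 add0r.
    apply: Rint_potential_bound => //.
    - by apply: L1onB => //; exact: (pWm n.+1).1.
    - apply: addr_ge0 => //; apply: mulr_ge0; first exact: Q_ge0.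
      by apply: mulr_ge0 => //; exact: exprn_ge0.
    - by move=> t t01; rewrite mulr0 add0r ddist.
  have ce : e @ \oo --> (0 : R).
    pose K1 := A2 / (1 - r) + Q * (A2 / (1 - r)) + `|l| * (A2 / (1 - r))
      + B * (A1 / (1 - r)) + k ^+ 2 * (A2 / (1 - r)).
    pose K2 := A2 * (A1 / (1 - r)).
    have -> : e = (fun n => K1 * r ^+ n + K2 * (n%:R * r ^+ n)).
      by apply: funext => n; rewrite /e /c /K1 /K2; ring.
    rewrite -[X in _ --> X](addr0 (0 : R)); apply: cvgD.
      rewrite -(mulr0 K1); apply: cvgM; first exact: cvg_cst.
      by apply: cvg_expr; rewrite ger0_norm.
    rewrite -(mulr0 K2); apply: cvgM; first exact: cvg_cst.
    exact: cvg_natM_geometric.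
  have : `|W x - Rint dW 0 x| <= 0.
    by apply: (cvgr_to_ge ce); apply: nearW.
  by rewrite normr_le0 subr_eq0 W0 add0r => /eqP.
- by split; [apply: W01 => //; rewrite lexx ler01 | apply: W01 => //;
    rewrite lexx ler01 | rewrite /dW Rint_point].
Qed.

End Estimates.
End Corrections.

(** * The transmission problem *)

Section Transmission.
Variable R : realType.
Implicit Types (q f g : R -> R).

Definition glue f g (x : R) := if x <= 1/2 then f x else g x.

Lemma glue_l f g x : x <= 1/2 -> glue f g x = f x.
Proof. by rewrite /glue => ->. Qed.

Lemma glue_r f g x : f (1/2) = g (1/2) -> 1/2 <= x -> glue f g x = g x.
Proof. by move=> fg; rewrite /glue le_eqVlt; case: ltgtP => // <-. Qed.

Lemma prim_glue f1 f2 df1 df2 : f1 (1/2) = f2 (1/2) -> df1 (1/2) = df2 (1/2) ->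
  prim 0 (1/2) f1 df1 -> prim (1/2) 1 f2 df2 ->
  prim 0 1 (glue f1 f2) (glue df1 df2).
Proof.
move=> e de h1 h2; apply: (@prim_cat _ 0 1 (1/2)); [lra | lra | |].
- by apply: eq_prim h1 => x /andP[_ x2]; rewrite glue_l.
- by apply: eq_prim h2 => x /andP[x2 _]; rewrite glue_r.
Qed.

Lemma bdm_glue f1 f2 : f1 (1/2) = f2 (1/2) -> bdm 0 (1/2) f1 -> bdm (1/2) 1 f2 ->
  bdm 0 1 (glue f1 f2).
Proof.
move=> e [m1 [B1 h1]] [m2 [B2 h2]]; split.
  have -> : `[0 : R, 1]%classic = `[0, 1/2] `|` `[1/2, 1].
    apply/seteqP; split => x /=; rewrite !in_itv /=.
      by move=> /andP[x0 x1]; have [xh|xh] := leP x (1/2);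
        [left | right; rewrite (ltW xh)]; rewrite ?x0.
    by case=> /andP[xa xb]; lra.
  apply/measurable_funU => //; split.
    apply: eq_measurable_fun m1 => x /set_mem /=; rewrite in_itv /=.
    by move=> /andP[_ xh]; rewrite glue_l.
  apply: eq_measurable_fun m2 => x /set_mem /=; rewrite in_itv /=.
  by move=> /andP[xh _]; rewrite glue_r.
exists (Num.max B1 B2) => x /andP[x0 x1]; rewrite /glue.
have [xh|/ltW xh] := leP x (1/2); rewrite le_max.
  by rewrite h1 ?x0.
by rewrite h2 ?xh ?orbT.
Qed.

Lemma FDseq_corrections q k v1 v2 lam u1 u2 du1 du2 : v1 (1/2) = v2 (1/2) ->
  FDseq q (k ^+ 2) v1 v2 lam u1 u2 du1 du2 ->
  (forall j, u1 j (1/2) = u2 j (1/2)) /\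
  corrections q k (glue v1 v2) lam (fun j => glue (u1 j) (u2 j))
    (fun j => glue (du1 j) (du2 j)).
Proof.
move=> vh [lam0 [hu1 [hu2 hS]]].
have uh j : u1 j (1/2) = u2 j (1/2).
  case: j => [|j]; first by rewrite hu1 ?hu2 ?vh //; lra.
  have [_ [_ [_ [_ [_ [h _]]]]]] := hS j.
  by apply/esym/eqP; rewrite -subr_eq0 h.
split => //; split => //; split.
  move=> x /andP[x0 x1]; have [xh|/ltW xh] := leP x (1/2).
    by rewrite !glue_l // hu1 // x0.
  by rewrite !glue_r // hu2 // xh.
move=> j; have [/sol_onE[a1 b1] [/sol_onE[a2 b2] [z0 [z1 [dz [_ dh]]]]]] := hS j.
have duh : du1 j.+1 (1/2) = du2 j.+1 (1/2).
  by apply/esym/eqP; rewrite -subr_eq0 dh.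
(* [prim_glue] matches the densities at the node itself; they agree there because every u^(p) is
   continuous across 1/2 and both sides share the value q(1/2). *)
have rh : FDrhs q lam u1 j (1/2) - lam 0%N * u1 j.+1 (1/2)
        = FDrhs q lam u2 j (1/2) - lam 0%N * u2 j.+1 (1/2).
  rewrite /FDrhs !uh; congr (- _ + _ - _).
  by apply: eq_bigr => p _; rewrite uh.
split; last first.
  split; [rewrite glue_l //; lra | rewrite glue_r //; lra | rewrite glue_l //; lra].
apply/sol_onE; split; first exact: prim_glue.
apply: eq_prim (prim_glue duh rh b1 b2) => // x /andP[x0 x1].
rewrite /FDrhs /glue lam0; case: (x <= 1/2) => //.
Qed.

Lemma corrections_FDseq q k v1 v2 lam u du : v1 (1/2) = v2 (1/2) ->
  corrections q k (glue v1 v2) lam u du ->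
  FDseq q (k ^+ 2) v1 v2 lam u u du du.
Proof.
move=> vh [lam0 [u0 hS]]; split => //; split.
  by move=> x /andP[x0 x1]; rewrite u0 ?glue_l //; lra.
split; first by move=> x /andP[x0 x1]; rewrite u0 ?glue_r //; lra.
move=> j; have [/sol_onE[a b] [z0 z1 dz]] := hS j.
rewrite lam0; split.
  by apply/sol_onE; split; [apply: primS a _ _ | apply: primS b _ _] => //; lra.
split; last by rewrite !subrr.
by apply/sol_onE; split; [apply: primS a _ _ | apply: primS b _ _] => //; lra.
Qed.

(** This is the minimum over sigma > 1 of (11/3)(sigma + (8/3) sigma^2)/(sigma - 1), attained at 1 +
    sqrt(11/8): the optimal eta for beta = 1, delta = 3/8, the data of the reflected trial pair. *)
Definition gconst : R := 11/3 * (1 + 16/3 + 2 * Num.sqrt (88/9)).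

Lemma gconst_gt0 : 0 < gconst.
Proof. by rewrite /gconst mulr_gt0 //; have := sqrtr_ge0 (88/9 : R); lra. Qed.

(** Valid also for a vanishing norm, because 1/0 = 0; passing to the inverse lets the eigenvalue
    estimate cover q = 0 without a separate case. *)
Lemma invr_Rconst q : (Rconst q)^-1 = gconst * normL1 q.
Proof. by rewrite /Rconst div1r invrK /gconst; ring. Qed.

(* The geometric ratio [h * normL1 q] obtained from the majorant is strictly
   smaller than [r = g * normL1 q], hence any polynomial factor can be absorbed
   and [eps = 1] works. *)
Lemma FD_converges_of q (k lam0 : R) v1 v2 dv1 dv2 (B d h s g r Ku : R) :
  L1on q 0 1 -> 0 < k -> lam0 = k ^+ 2 ->
  sol_on 0 (1/2) v1 dv1 (fun x => - k ^+ 2 * v1 x) ->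
  sol_on (1/2) 1 v2 dv2 (fun x => - k ^+ 2 * v2 x) ->
  v1 0 = 0 -> v2 1 = 0 -> dv1 0 = 1 ->
  v2 (1/2) - v1 (1/2) = 0 -> dv2 (1/2) - dv1 (1/2) = 1 ->
  (forall x, `|v1 x| <= B) -> (forall x, `|v2 x| <= B) ->
  0 < d ->
  `|Rint (fun t => sin (k * (1 - t)) * v1 t) 0 (1/2)
    + Rint (fun t => sin (k * (1 - t)) * v2 t) (1/2) 1| = d ->
  0 < h -> 0 <= s ->
  B + ((1 + B / d) / k * s + (1 + B / d) / (k * d) * s ^+ 2) / h <= s ->
  h < g -> r = g * normL1 q -> r < 1 -> 0 < Ku ->
  FD_converges q lam0 v1 v2 r Ku.
Proof.
move=> hq k0 -> /sol_onE[pv1 pdv1] /sol_onE[pv2 pdv2] v10 v21 dv10 vjump dvjump.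
move=> B1 B2 d0 hd h0 s0 super hg rE r1 Ku0.
have vh : v1 (1/2) = v2 (1/2) by apply/esym/eqP; rewrite -subr_eq0 vjump.
have hh : (0 : R) <= 1/2 by lra.
have hh1 : (1/2 : R) <= 1 by lra.
pose v := glue v1 v2.
have bv : bdm 0 1 v.
  by apply: bdm_glue => //; [exact: prim_bdm pv1 | exact: prim_bdm pv2].
have hB x : 0 <= x <= 1 -> `|v x| <= B by rewrite /v /glue; case: ifP.
have hD : d <= `|Rint (fun t => sin (k * (1 - t)) * v t) 0 1|.
  rewrite -hd (@Rint_split _ 0 1 (1/2)); last 2 first.
  - by apply: L1onM_bdm (bdm_L1on bv); exact: bdm_sinB.
  - by rewrite hh hh1.
  rewrite le_eqVlt; apply/orP; left; apply/eqP; congr (`|_ + _|).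
    by apply: eq_Rint => t /andP[_ th]; rewrite /v glue_l.
  by apply: eq_Rint => t /andP[th _]; rewrite /v glue_r.
split.
  have [lam [u [du hc]]] := corrections_exist hq k0 bv d0 hD.
  by exists lam, u, u, du, du; exact: corrections_FDseq.
move=> lam u1 u2 du1 du2 /(FDseq_corrections vh)[uh hc].
set u := (fun j => glue (u1 j) (u2 j)) in hc.
have B0 : 0 <= B by exact: le_trans (B1 0).
have Q0 : 0 <= normL1 q by exact: Q_ge0.
have hl := lam_geometric hq k0 bv hB d0 hD hc h0 s0 super.
have hu := u_geometric hq k0 bv hB d0 hD hc h0 s0 super.
set kap := 1 + B / d in hu super.
have kap0 : 0 < kap by rewrite /kap ltr_pwDl // divr_ge0 // ltW.
pose r' := normL1 q * h.
have r'0 : 0 <= r' by rewrite mulr_ge0 // ltW.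
have r'r : r' <= r by rewrite rE /r' mulrC ler_wpM2r // ltW.
have r'1 : r' < 1 by exact: le_lt_trans r1.
have A10 : 0 <= normL1 q * (s / d) by rewrite mulr_ge0 // divr_ge0 // ltW.
have A20 : 0 <= normL1 q * (kap / k * s).
  by rewrite !mulr_ge0 ?invr_ge0 // ltW.
have r'01 : 0 <= r' < 1 by rewrite r'0.
have [L [W [dW [/sol_onE[pW pdW] [W0 W1 dW0] tl tu]]]] :=
  corrections_limit hq bv hB hc r'01 A10 A20 hl hu.
have ul j x : 0 <= x <= 1/2 -> u j x = u1 j x by move=> /andP[_ ?]; rewrite /u glue_l.
have ur j x : 1/2 <= x <= 1 -> u j x = u2 j x by move=> /andP[? _]; rewrite /u glue_r.
have vl x : 0 <= x <= 1/2 -> v x = v1 x by move=> /andP[_ ?]; rewrite /v glue_l.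
have vr x : 1/2 <= x <= 1 -> v x = v2 x by move=> /andP[? _]; rewrite /v glue_r.
have psl x : 0 <= x <= 1/2 -> psum (fun j => u1 j x) = psum (fun j => u j x).
  by move=> xh; congr psum; apply: funext => j; rewrite ul.
have psr x : 1/2 <= x <= 1 -> psum (fun j => u2 j x) = psum (fun j => u j x).
  by move=> xh; congr psum; apply: funext => j; rewrite ur.
have inl (x : R) : 0 <= x <= 1/2 -> 0 <= x <= 1 by move=> /andP[? ?]; lra.
have inr (x : R) : 1/2 <= x <= 1 -> 0 <= x <= 1 by move=> /andP[? ?]; lra.
pose U x := v x + W x.
(* The unit slope at 0 and the unit jump of the derivative come from the trial pair; [W] and [dW]
   are common to both halves. *)
exists L, U, U, (fun x => dv1 x + dW x), (fun x => dv2 x + dW x).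
split.
  split.
    have pW' : prim 0 (1/2) W dW by apply: primS pW _ _.
    have pdW' : prim 0 (1/2) dW _ := primS pdW (lexx _) hh1.
    apply/sol_onE; split.
      by apply: eq_prim (primD pv1 pW') => // x xh; rewrite /U vl.
    by apply: eq_prim (primD pdv1 pdW') => // x xh; rewrite /U vl //; ring.
  split.
    have pW' : prim (1/2) 1 W dW by apply: primS pW _ _.
    have pdW' : prim (1/2) 1 dW _ := primS pdW hh (lexx _).
    apply/sol_onE; split.
      by apply: eq_prim (primD pv2 pW') => // x xh; rewrite /U vr.
    by apply: eq_prim (primD pdv2 pdW') => // x xh; rewrite /U vr //; ring.
  rewrite /U vl ?lexx // v10 W0 vr ?hh1 ?lexx // v21 W1 dv10 dW0 subrr !addr0.
  by do 4 split => //; rewrite opprD addrACA subrr addr0 dvjump.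
split; first exact: cvg_geometric_dist tl.
split.
  by move=> x xh; rewrite psl //; apply: cvg_geometric_dist (tu x (inl x xh)).
split.
  by move=> x xh; rewrite psr //; apply: cvg_geometric_dist (tu x (inr x xh)).
have g0 : 0 < g by exact: lt_trans hg.
have [K K0 hK] : exists2 K, 0 < K & forall m : nat, m.+1%:R ^+ 2 * (h / g) ^+ m <= K.
  by apply: sqr_geometric_bound; rewrite divr_ge0 ?(ltW h0) ?(ltW g0) //= ltr_pdivrMr ?mul1r.
have hK' m : r' ^+ m <= K * r ^+ m / m.+1%:R ^+ 2.
  rewrite ler_pdivlMr ?exprn_gt0 //.
  have -> : r' = h / g * r by rewrite rE /r'; field; rewrite gt_eqF.
  rewrite exprMn.
  have := ler_wpM2r (exprn_ge0 m (_ : 0 <= r)) (hK m).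
  move=> /(_ (le_trans r'0 r'r)); apply: le_trans.
  by rewrite le_eqVlt; apply/orP; left; apply/eqP; ring.
pose E1 := s / d / (1 - r'); pose E2 := kap / k * s / (1 - r').
have r'p : 0 < 1 - r' by rewrite subr_gt0.
have rp : 0 < 1 - r by rewrite subr_gt0.
have E10 : 0 <= E1 by rewrite !divr_ge0 // ltW.
have E20 : 0 <= E2.
  by rewrite divr_ge0 ?(ltW r'p) // mulr_ge0 // divr_ge0 // ltW.
have gc0 := gconst_gt0.
(* One summand for each of the two estimates, and 1 for positivity. The witness (1 - r) C below
   undoes the normalisation c/(1 - r). *)
pose C := K * E1 / gconst + K * E2 / (Ku * g) + 1.
have Kge0 := ltW K0; have gcge0 := ltW gc0.
have Kg0 : 0 <= Ku * g by rewrite mulr_ge0 // ltW.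
have C1 : 0 <= K * E1 / gconst by apply: divr_ge0 => //; exact: mulr_ge0.
have C2 : 0 <= K * E2 / (Ku * g) by apply: divr_ge0 => //; exact: mulr_ge0.
have C0 : 0 < C by rewrite /C; lra.
exists ((1 - r) * C), 1; split; first exact: mulr_gt0.
split=> // C' m.
have -> : C' = C by rewrite /C' mulrC mulKf // gt_eqF.
have pw : powR m.+1%:R (1 + 1 : R) = m.+1%:R ^+ 2.
  by rewrite -(powR_mulrn 2).
rewrite pw.
have X0 : 0 < m.+1%:R ^+ 2 :> R by rewrite exprn_gt0.
set X := m.+1%:R ^+ 2 in pw X0 *.
have r0 : 0 <= r by exact: le_trans r'r.
have rm0 : 0 <= r ^+ m by exact: exprn_ge0.
have Xi0 : 0 <= X^-1 by rewrite invr_ge0 ltW.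
have ub x : 0 <= x <= 1 ->
    `|U x - psum (fun j => u j x) m| <= Ku * C / X * r ^+ m.+1.
  move=> x01; apply: le_trans (tu x x01 m) _.
  have -> : normL1 q * (kap / k * s) / (1 - r') * r' ^+ m
      = normL1 q * E2 * r' ^+ m by rewrite /E2; ring.
  apply: le_trans (ler_wpM2l (mulr_ge0 Q0 E20) (hK' m)) _.
  have -> : normL1 q * E2 * (K * r ^+ m / m.+1%:R ^+ 2)
     = Ku * (K * E2 / (Ku * g)) / X * r ^+ m.+1.
    (* The L1 norm in front of the tail bound equals r/g and supplies the extra power of r; in the
       eigenvalue estimate it is matched with the inverse of [Rconst q] instead. *)
    have -> : r ^+ m.+1 = g * normL1 q * r ^+ m by rewrite exprS {1}rE.
    by rewrite -/X; field; rewrite !gt_eqF.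
  rewrite ler_wpM2r ?exprn_ge0 // ler_wpM2r // ler_wpM2l ?(ltW Ku0) //.
  by rewrite /C; lra.
split; first by move=> x xh; rewrite psl //; exact/ub/inl.
split; first by move=> x xh; rewrite psr //; exact/ub/inr.
rewrite invfM invr_Rconst; apply: le_trans (tl m) _.
have -> : normL1 q * (s / d) / (1 - r') * r' ^+ m
    = normL1 q * E1 * r' ^+ m by rewrite /E1; ring.
apply: le_trans (ler_wpM2l (mulr_ge0 Q0 E10) (hK' m)) _.
have -> : normL1 q * E1 * (K * r ^+ m / m.+1%:R ^+ 2)
   = K * E1 / gconst * (X^-1 * (gconst * normL1 q)) * r ^+ m.
  by rewrite -/X; field; rewrite !gt_eqF.
rewrite ler_wpM2r // ler_wpM2r //; last by rewrite /C; lra.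
by rewrite !mulr_ge0 // ltW.
Qed.

End Transmission.

(** * The trial eigenpairs *)

Section TrialPairs.
Variable R : realType.
Implicit Types (q : R -> R) (k : R).

Lemma continuous_sin_affine k (c m : R) : continuous (fun x : R => sin (k * (c + m * x))).
Proof.
move=> x; apply: continuous_comp; last exact: continuous_sin.
apply: cvgM; first exact: cvg_cst.
by apply: cvgD; [exact: cvg_cst | apply: cvgM; [exact: cvg_cst | exact: cvg_id]].
Qed.

Lemma continuous_cos_affine k (c m : R) : continuous (fun x : R => cos (k * (c + m * x))).
Proof.
move=> x; apply: continuous_comp; last exact: continuous_cos.
apply: cvgM; first exact: cvg_cst.
by apply: cvgD; [exact: cvg_cst | apply: cvgM; [exact: cvg_cst | exact: cvg_id]].
Qed.

Lemma prim_sin_affine (a b k c m : R) :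
  prim a b (fun x => sin (k * (c + m * x))) (fun x => k * m * cos (k * (c + m * x))).
Proof.
apply: prim_C1 => [x|].
  by apply: is_derive_eq; rewrite /GRing.scale /=; ring.
by move=> x; apply: cvgM; [exact: cvg_cst | exact: continuous_cos_affine].
Qed.

Lemma prim_cos_affine (a b k c m : R) :
  prim a b (fun x => cos (k * (c + m * x))) (fun x => - (k * m) * sin (k * (c + m * x))).
Proof.
apply: prim_C1 => [x|].
  by apply: is_derive_eq; rewrite /GRing.scale /=; ring.
by move=> x; apply: cvgM; [exact: cvg_cst | exact: continuous_sin_affine].
Qed.

Lemma prim_id (a b : R) : prim a b id (fun=> 1).
Proof. by apply: prim_C1 => x; exact: cvg_cst. Qed.

Lemma Rint_prim (a b : R) f df : a <= b -> prim a b f df -> Rint df a b = f b - f a.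
Proof. by move=> ab h; rewrite (prim_incr h). Qed.

Lemma cos_double (x : R) : cos (2 * x) = 2 * cos x ^+ 2 - 1.
Proof. by rewrite mulr_natl cos_mulr2n -mulr_natl. Qed.

(** For x = 2 pi/3 one has cos 3x = 1, and cos 3x - 1 = (cos x - 1)(2 cos x + 1)^2. The sign of cos
    x in the second quadrant excludes the first factor. *)
Lemma cos_2piBthird : cos (2 * pi / 3 : R) = - (1/2).
Proof.
set x := 2 * pi / 3; have pi0 := pi_gt0 R.
have h : cos (2 * x + x) = 1.
  have -> : 2 * x + x = 2 * pi by rewrite /x; field.
  rewrite mulr_natl.
  exact: cos2pi.
have sx := cos2Dsin2 x; have s2 := sin_mulr2n x.
rewrite -[x *+ 2]mulr_natl -[(_ * _) *+ 2]mulr_natl in s2.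
rewrite cosD cos_double s2 in h.
have c0 : cos x < 0.
  have -> : x = (x - pi / 2) + pi / 2 by ring.
  rewrite cosDpihalf oppr_lt0 sin_gt0_pihalf // /x; lra.
have : (cos x - 1) * (2 * cos x + 1) ^+ 2 = 0.
  have -> : (cos x - 1) * (2 * cos x + 1) ^+ 2
    = (2 * cos x ^+ 2 - 1) * cos x - 2 * (cos x * sin x) * sin x - 1
      + 2 * cos x * (cos x ^+ 2 + sin x ^+ 2 - 1) by ring.
  by rewrite h sx; ring.
by move/eqP; rewrite mulf_eq0 sqrf_eq0 => /orP[] /eqP; lra.
Qed.

Lemma sin_pi_nat (n : nat) : sin (pi * n%:R : R) = 0.
Proof.
elim: n => [|n IH]; first by rewrite mulr0 sin0.
by rewrite -natr1 mulrDr mulr1 sinDpi IH oppr0.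
Qed.

Lemma cos_pi_nat (n : nat) : cos (pi * n%:R : R) = (-1) ^+ n.
Proof.
elim: n => [|n IH]; first by rewrite mulr0 cos0.
by rewrite -natr1 mulrDr mulr1 cosDpi IH exprS mulN1r.
Qed.

(** Sharp enough to give 2 [gconst] > 90, the margin of the case n odd. *)
Lemma sqrt_88_9 : 312/100 <= Num.sqrt (88/9 : R).
Proof. by rewrite -(ler_sqr) ?nnegrE ?sqrtr_ge0 // sqr_sqrtr //; lra. Qed.

(** The condition cos(k/2) = -1/2 is what part (a) supplies about the frequency: it makes the
    derivative jump -2 cos(k/2) equal to 1, and gives cos k = -1/2. *)
Lemma FD_converges_reflected q k : L1on q 0 1 -> 0 < k -> cos (k * (1/2)) = - (1/2) ->
  let r := (2 + Num.sqrt 3) * (11/3 * normL1 q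
                  * (1 + 16/3 + 2 * Num.sqrt (88/9))) / (Num.sqrt 3 * k) in
  r < 1 ->
  FD_converges q (k ^+ 2) (fun x => sin (k * x) / k) (fun x => sin (k * (1 - x)) / k)
    r (3 / (8 * k)).
Proof.
move=> hq k0 ck r r1; have kn0 : k != 0 by rewrite gt_eqF.
have sinb x : `|sin x / k| <= k^-1.
  by rewrite normrM normfV (gtr0_norm k0) ler_pdivrMr // mulVf // sin_abs_le1.
have sE x : sin (k * (1 - x)) = sin (k * (1 + (-1) * x)) by rewrite mulN1r.
have cE x : cos (k * (1 - x)) = cos (k * (1 + (-1) * x)) by rewrite mulN1r.
have h3 : 0 < Num.sqrt 3 :> R by rewrite sqrtr_gt0.
have h3' : Num.sqrt 3 <= 2 :> R.
  by rewrite -(ler_sqr) ?nnegrE ?sqrtr_ge0 // sqr_sqrtr //; lra.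
have h88 := sqrt_88_9.
(* Here |D| = 3/(8k) and kap = 11/3. The value 9/4 is close to the minimiser 1 + sqrt(11/8), and h =
   143/(3k) turns kap/(k h) into 1/13. *)
apply: (@FD_converges_of R q k _ _ _ (fun x => cos (k * x))
  (fun x => - cos (k * (1 - x))) k^-1 (3 / (8 * k)) (143 / (3 * k)) (9 / (4 * k))
  ((2 + Num.sqrt 3) * gconst R / (Num.sqrt 3 * k))) => //.
- apply/sol_onE; split.
    apply: eq_prim (primZ k^-1 (prim_sin 0 (1/2) k)) => x _; first by rewrite mulrC.
    by rewrite mulKf.
  by apply: eq_prim (prim_cos 0 (1/2) k) => x _ //; field.
- apply/sol_onE; split.
    apply: eq_prim (primZ k^-1 (prim_sin_affine (1/2) 1 k 1 (-1))) => x _.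
      by rewrite sE mulrC.
    by rewrite cE; field.
  apply: eq_prim (primZ (-1) (prim_cos_affine (1/2) 1 k 1 (-1))) => x _.
    by rewrite !mulN1r.
  by rewrite sE; field.
- by rewrite mulr0 sin0 mul0r.
- by rewrite subrr mulr0 sin0 mul0r.
- by rewrite mulr0 cos0.
- by rewrite (_ : 1 - 1/2 = 1/2 :> R) ?subrr //; lra.
- by rewrite (_ : 1 - 1/2 = 1/2 :> R) ?ck //; lra.
- by rewrite divr_gt0 // mulr_gt0.
(* Product to sum: sin(k(1-t)) sin(kt) = (cos(k(1-2t)) - cos k)/2. The sin k terms from the two
   halves cancel, leaving 3/(8k). *)
- have P1 : prim 0 (1/2) (fun t => (2 * k)^-1 *
        ((- (2 * k)^-1) * sin (k * (1 + (-2) * t)) - cos k * t))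
      (fun t => sin (k * (1 - t)) * (sin (k * t) / k)).
    apply: eq_prim (primZ (2 * k)^-1 (primB
      (primZ (- (2 * k)^-1) (prim_sin_affine 0 (1/2) k 1 (-2)))
      (primZ (cos k) (prim_id 0 (1/2))))) => t _ //.
    rewrite (_ : k * (1 + -2 * t) = k * (1 - t) - k * t); last by ring.
    rewrite (_ : cos k = cos (k * (1 - t) + k * t)); last by congr cos; ring.
    by rewrite cosB cosD; field.
  have P2 : prim (1/2) 1 (fun t => (2 * k)^-1 *
        (t + (2 * k)^-1 * sin ((2 * k) * (1 + (-1) * t))))
      (fun t => sin (k * (1 - t)) * (sin (k * (1 - t)) / k)).
    apply: eq_prim (primZ (2 * k)^-1 (primD (prim_id (1/2) 1)
      (primZ (2 * k)^-1 (prim_sin_affine (1/2) 1 (2 * k) 1 (-1))))) => t _ //.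
    rewrite (_ : 2 * k * (1 + -1 * t) = 2 * (k * (1 - t))); last by ring.
    rewrite cos_double.
    by have := cos2sin2 (k * (1 - t)) => ->; field.
  rewrite (Rint_prim _ P1) ?(Rint_prim _ P2); [|lra|lra].
  have -> : k * (1 + -2 * (1/2)) = 0 by field.
  have -> : 2 * k * (1 + -1 * 1) = 0 by ring.
  have -> : 2 * k * (1 + -1 * (1/2)) = k by field.
  have -> : k * (1 + -2 * 0) = k by ring.
  have -> : cos k = - (1/2).
    have -> : k = 2 * (k * (1/2)) by field.
    by rewrite cos_double ck; field.
  rewrite sin0.
  set X := (X in `|X|); have -> : X = 3 / (8 * k) by rewrite /X; field.
  by rewrite gtr0_norm // divr_gt0 // mulr_gt0.
- by rewrite divr_gt0 // mulr_gt0.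
- by rewrite divr_ge0 // mulr_ge0 // ltW.
- set X := (X in X <= _); have -> : X = (2 + 1/13 * (9/4) - 1 + 8/39 * (81/16)) / k.
    by rewrite /X; field.
  have -> : 9 / (4 * k) = (9/4) / k by field.
  by rewrite ler_wpM2r ?invr_ge0 ?(ltW k0) //; lra.
- rewrite ltr_pdivrMr ?mulr_gt0 //.
  have -> : (2 + Num.sqrt 3) * gconst R / (Num.sqrt 3 * k) * (3 * k)
    = (2 + Num.sqrt 3) / Num.sqrt 3 * (3 * gconst R) by field; rewrite kn0 gt_eqF.
  have h2 : 2 <= (2 + Num.sqrt 3) / Num.sqrt 3 :> R by rewrite ler_pdivlMr //; lra.
  have h4 : 90 <= 3 * gconst R by rewrite /gconst; lra.
  by nra.
- by rewrite /r /gconst; field; rewrite kn0 gt_eqF.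
- by rewrite divr_gt0 // mulr_gt0.
Qed.

(** Here sin(k(1-t)) = - sin(kt), so D is minus a weighted integral of sin^2 and |D| = (2 +
    (-1)^n)/(4k). For n odd the trial function vanishes on the right half; |D| drops to a third of
    its even value, which makes this the tight case. *)
Lemma FD_converges_resonant q n : L1on q 0 1 -> (0 < n)%N ->
  let k : R := 2 * pi * n%:R in
  let r := 1 / (pi * n%:R * Rconst q) in
  r < 1 ->
  FD_converges q (k ^+ 2) (fun x => sin (k * x) / k)
    (fun x => ((-1) ^+ n + 1) / k * sin (k * x))
    r (if odd n then 1 / (8 * pi * n%:R) else 3 / (8 * pi * n%:R)).
Proof.
move=> hq n0 k r r1; have pi0 := pi_gt0 R.
have n0' : 0 < n%:R :> R by rewrite ltr0n.
have pn0 : 0 < pi * n%:R :> R by rewrite mulr_gt0.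
have k0 : 0 < k by rewrite /k -mulrA mulr_gt0.
have kn0 : k != 0 by rewrite gt_eqF.
have kh : k * (1/2) = pi * n%:R by rewrite /k; field.
have k1 : k = pi * (2 * n)%:R by rewrite natrM /k; ring.
have ck : cos k = 1 by rewrite k1 cos_pi_nat mulnC exprM sqrr_sign.
have sk : sin k = 0 by rewrite k1 sin_pi_nat.
have pE : pi * n%:R = k / 2 by rewrite /k; field.
have rE : r = 2 * gconst R / k * normL1 q.
  by rewrite /r div1r invfM invr_Rconst pE; field.
have h88 := sqrt_88_9.
set e : R := (-1) ^+ n.
have sinb x : `|sin x / k| <= k^-1.
  by rewrite normrM normfV (gtr0_norm k0) ler_pdivrMr // mulVf // sin_abs_le1.
have sol1 (a b c : R) :
    sol_on a b (fun x => c / k * sin (k * x)) (fun x => c * cos (k * x))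
      (fun x => - k ^+ 2 * (c / k * sin (k * x))).
  apply/sol_onE; split.
    by apply: eq_prim (primZ (c / k) (prim_sin a b k)) => x _ //; field.
  by apply: eq_prim (primZ c (prim_cos a b k)) => x _ //; field.
have P (a b : R) : prim a b (fun t => 2^-1 * (t - (2 * k)^-1 * sin (2 * k * t)))
    (fun t => sin (k * t) * sin (k * t)).
  apply: eq_prim (primZ 2^-1 (primB (prim_id a b)
    (primZ (2 * k)^-1 (prim_sin a b (2 * k))))) => t _ //.
  rewrite -[2 * k * t]mulrA cos_double.
  by have := cos2sin2 (k * t) => ->; field.
have Dk (a b c : R) : a <= b ->
    Rint (fun t => sin (k * (1 - t)) * (c / k * sin (k * t))) a b
    = - (c / (2 * k)) * (b - a - (2 * k)^-1 * (sin (2 * k * b) - sin (2 * k * a))).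
  move=> ab; have PP : prim a b
      (fun t => - (c / k) * (2^-1 * (t - (2 * k)^-1 * sin (2 * k * t))))
      (fun t => sin (k * (1 - t)) * (c / k * sin (k * t))).
    apply: eq_prim (primZ (- (c / k)) (P a b)) => // t _.
    by rewrite mulrBr mulr1 sinB sk ck; field.
  by rewrite (Rint_prim ab PP); field.
have s2k : sin (2 * k * 1) = 0 by rewrite mulr1 mulr_natl sin_mulr2n sk mulr0 mul0rn.
have s2h : sin (2 * k * (1/2)) = 0.
  by have -> : 2 * k * (1/2) = k by field.
have s20 : sin (2 * k * 0) = 0 by rewrite mulr0 sin0.
have DE : Rint (fun t => sin (k * (1 - t)) * (sin (k * t) / k)) 0 (1/2)
    + Rint (fun t => sin (k * (1 - t)) * ((e + 1) / k * sin (k * t))) (1/2) 1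
    = - ((2 + e) / (4 * k)).
  have -> : Rint (fun t => sin (k * (1 - t)) * (sin (k * t) / k)) 0 (1/2)
      = Rint (fun t => sin (k * (1 - t)) * (1 / k * sin (k * t))) 0 (1/2).
    by apply: eq_Rint => t _; rewrite mul1r [k^-1 * _]mulrC.
  rewrite !Dk ?s2k ?s2h ?s20; [|lra|lra].
  by field.
have KuE (c : R) : c / (8 * pi * n%:R) = c / (4 * k).
  by rewrite -mulrA pE; field.
have base (B d h s Ku : R) : k^-1 <= B -> `|(e + 1) / k| <= B -> 0 < d ->
    d = (2 + e) / (4 * k) -> 0 < h -> 0 <= s ->
    B + ((1 + B / d) / k * s + (1 + B / d) / (k * d) * s ^+ 2) / h <= s ->
    h < 2 * gconst R / k -> 0 < Ku ->
    FD_converges q (k ^+ 2) (fun x => sin (k * x) / k)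
      (fun x => (e + 1) / k * sin (k * x)) r Ku.
  move=> hB1 hB2 d0 dE h0 s0 super hg Ku0.
  apply: (@FD_converges_of R q k _ _ _ (fun x => cos (k * x))
    (fun x => (e + 1) * cos (k * x)) B d h s (2 * gconst R / k)) => //.
  - have := sol1 0 (1/2) 1.
    have -> : (fun x => 1 / k * sin (k * x)) = (fun x => sin (k * x) / k).
      by apply: funext => x; rewrite mul1r mulrC.
    have -> : (fun x => 1 * cos (k * x)) = (fun x => cos (k * x)).
      by apply: funext => x; rewrite mul1r.
    have -> : (fun x => - k ^+ 2 * (1 / k * sin (k * x)))
       = (fun x => - k ^+ 2 * (sin (k * x) / k)).
      by apply: funext => x; rewrite mul1r [k^-1 * _]mulrC.
    by [].
  - by rewrite mulr0 sin0 mul0r.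
  - by rewrite mulr1 sk mulr0.
  - by rewrite mulr0 cos0.
  - by rewrite kh sin_pi_nat mul0r mulr0 subrr.
  - rewrite kh cos_pi_nat -/e mulrDl mul1r addrK.
    by rewrite /e -expr2 sqrr_sign.
  - by move=> x; apply: le_trans (sinb _) hB1.
  - move=> x; rewrite normrM; apply: le_trans hB2.
    by rewrite -[leRHS]mulr1 ler_wpM2l // sin_abs_le1.
  - by rewrite DE normrN -dE gtr0_norm.
have [nodd|neven] := boolP (odd n).
- have eE : e = -1 by rewrite /e -signr_odd nodd expr1.
  (* beta = 1, delta = 1/4, kap = 5: the minimum of 5 (sigma + 4 sigma^2)/(sigma - 1) is about
     89.72, at sigma = 1 + sqrt(5)/2. The values 17/8 and 90 are rational neighbours. *)
  apply: (base k^-1 (1 / (4 * k)) (90 / k) (17 / (8 * k))).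
  + by [].
  + by rewrite eE addNr mul0r normr0 invr_ge0 ltW.
  + by rewrite divr_gt0 // mulr_gt0.
  + by rewrite eE; field.
  + by rewrite divr_gt0.
  + by rewrite divr_ge0 // mulr_ge0 // ltW.
  + set X := (X in X <= _).
    have -> : X = (1 + (5 * (17/8) + 20 * (17/8) ^+ 2) / 90) / k by rewrite /X; field.
    have -> : 17 / (8 * k) = (17/8) / k by field.
    by rewrite ler_wpM2r ?invr_ge0 ?(ltW k0) //; lra.
  + by rewrite ltr_pM2r ?invr_gt0 // /gconst; lra.
  + by rewrite KuE divr_gt0 // mulr_gt0.
- have eE : e = 1 by rewrite /e -signr_odd (negbTE neven) expr0.
  (* beta = 2 and delta = 3/4 are twice the data of the reflected pair: kap and the optimal h are
     the same, and s doubles. *)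
  apply: (base (2 / k) (3 / (4 * k)) (143 / (3 * k)) (9 / (2 * k))).
  + by rewrite -[leLHS]mul1r ler_wpM2r ?invr_ge0 ?(ltW k0) //; lra.
  + by rewrite eE gtr0_norm // divr_gt0.
  + by rewrite divr_gt0 // mulr_gt0.
  + by rewrite eE; field.
  + by rewrite divr_gt0 // mulr_gt0.
  + by rewrite divr_ge0 // mulr_ge0 // ltW.
  + set X := (X in X <= _).
    have -> : X = (2 + (11/3 * (9/2) + 44/9 * (9/2) ^+ 2) * 3 / 143) / k.
      by rewrite /X; field.
    have -> : 9 / (2 * k) = (9/2) / k by field.
    by rewrite ler_wpM2r ?invr_ge0 ?(ltW k0) //; lra.
  + have -> : 143 / (3 * k) = (143/3) / k by field.
    by rewrite ltr_pM2r ?invr_gt0 // /gconst; lra.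
  + by rewrite KuE divr_gt0 // mulr_gt0.
Qed.

End TrialPairs.

Unset Implicit Arguments.
Local Close Scope classical_set_scope.

Theorem theorem1 (R : realType) (q : R -> R) (hq : L1on q 0 1) :
  (* (a): lam0 = 4 pi^2 (+-2/3 + 2n)^2, sign chosen by b *)
  (forall (n : nat) (b : bool),
     let lam0 : R := 4 * pi ^+ 2 * ((if b then 2/3 else - (2/3)) + 2 * n%:R) ^+ 2 in
     let k := Num.sqrt lam0 in
     let rn := (2 + Num.sqrt 3) * (11/3 * normL1 q
                  * (1 + 16/3 + 2 * Num.sqrt (88/9))) / (Num.sqrt 3 * k) in
     rn < 1 ->
     FD_converges q lam0 (fun x => sin (k * x) / k) (fun x => sin (k * (1 - x)) / k)
       rn (3 / (8 * k))) /\
  (* (b): lam0 = 4 pi^2 n^2, n >= 1 *)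
  (forall n : nat, (0 < n)%N ->
     let lam0 : R := 4 * pi ^+ 2 * n%:R ^+ 2 in
     let rn := 1 / (pi * n%:R * Rconst q) in
     rn < 1 ->
     FD_converges q lam0
       (fun x => sin (2 * pi * n%:R * x) / (2 * pi * n%:R))
       (fun x => ((-1) ^+ n + 1) / (2 * pi * n%:R) * sin (2 * pi * n%:R * x))
       rn (if odd n then 1 / (8 * pi * n%:R) else 3 / (8 * pi * n%:R))).
Proof.
split=> [n b lam0 k rn r1|n n0 lam0 rn r1].
- pose w : R := (if b then 2/3 else - (2/3)) + 2 * n%:R.
  have w0 : w != 0.
    rewrite /w; case: (b); first by rewrite gt_eqF // ltr_pwDl // mulr_ge0.
    case: (n) => [|m]; first by rewrite mulr0 addr0 oppr_eq0 gt_eqF.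
    have m0 : 0 <= m%:R :> R by [].
    by rewrite -natr1 gt_eqF //; lra.
  have pi0 := pi_gt0 R.
  (* The absolute value matters for n = 0 with the lower sign, where w = -2/3; evenness of the
     cosine removes it below. *)
  have kE : k = 2 * `|pi * w|.
    have lam0E : lam0 = (2 * (pi * w)) ^+ 2 by rewrite /lam0 -/w; ring.
    by rewrite /k lam0E sqrtr_sqr normrM ger0_norm.
  have k0 : 0 < k by rewrite kE mulr_gt0 // normr_gt0 mulf_neq0 // gt_eqF.
  have lam0E : lam0 = k ^+ 2.
    by rewrite sqr_sqrtr // /lam0 mulr_ge0 ?sqr_ge0 // mulr_ge0 // sqr_ge0.
  have ck : cos (k * (1/2)) = - (1/2).
    have -> : k * (1/2) = `|pi * w| by rewrite kE; field.
    rewrite cos_norm /w mulrDr.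
    have -> : pi * (2 * n%:R) = pi * (2 * n)%:R :> R by rewrite natrM.
    rewrite cosD cos_pi_nat sin_pi_nat mulr0 subr0 mulnC exprM sqrr_sign mulr1.
    case: (b); first by rewrite -cos_2piBthird; congr cos; ring.
    by rewrite -cos_2piBthird -cosN; congr cos; ring.
  by have := FD_converges_reflected hq k0 ck r1; rewrite -lam0E.
- have -> : lam0 = (2 * pi * n%:R) ^+ 2 by rewrite /lam0; ring.
  exact: FD_converges_resonant.
Qed.
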